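(* With notation as in the context, the map $\Lambda$ is a $C^\infty$-diffeomorphism from $\Omega_{-,4}$ onto $\mathbb R^2_{<,+}$. Furthermore, let $|x|>0$, $u\in\mathbb R^2_{<,+}$, $x=|x|e_1$, $t=\frac{|x|^2}{4}(u,0)$ and $\theta=(\Lambda^{-1}(u),0)\in\mathbb R^3$. Then the Hessian matrix of $\tau\mapsto\phi((x,t);\tau)$ at $\tau=\theta$ is nonsingular and has exactly two positive eigenvalues.
   Context: Work in $N_{3,2}=\mathbb R^3\times\mathbb R^3$ (step-two group with $\sum_j\tau_jU^{(j)}=\begin{pmatrix}0&\tau_3&-\tau_2\\-\tau_3&0&\tau_1\\\tau_2&-\tau_1&0\end{pmatrix}$); $e_1,e_2$ standard basis vectors. $\psi(s)=(1-s\cot s)/s^2$ for $s\notin\pi\mathbb Z\setminus\{0\}$ ($\psi(0)=1/3$). For $\tau\in\mathbb R^3$ with $|\tau|\notin\pi\mathbb Z\setminus\{0\}$ and $(x,t)\in\mathbb R^3\times\mathbb R^3$, $\phi((x,t);\tau)=|x|^2|\tau|\cot|\tau|+\psi(|\tau|)\langle\tau,x\rangle^2+4t\cdot\tau$. $\vartheta_1$ is the unique solution of $\tan s=s$ in $(\pi,\frac32\pi)$. For $v=(v_1,v_2)\in\mathbb R^2$, $r=|v|$: $\Lambda(v)=v_2\big[\frac{\psi'(r)}{r}v_2v+2\psi(r)e_2\big]$ (with $e_2=(0,1)$ here), $\mathrm K_3(v)=2\psi(r)+\frac{\psi'(r)}{r}v_2^2$, $\Omega_{-,4}=\{v:\ v_2<0,\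 \pi<v_1<r<\vartheta_1,\ \mathrm K_3(v)<0\}$, and $\mathbb R^2_{<,+}=\{(u_1,u_2):u_1>0,\ 0<u_2<\frac2{\sqrt\pi}\sqrt{u_1}\}$. *)

(* Defs.v *)
From Stdlib Require Import Reals.
From Coquelicot Require Import Coquelicot.
From mathcomp Require Import all_boot all_order all_algebra.
From mathcomp Require Import Rstruct.

Set Implicit Arguments.
Unset Strict Implicit.
Unset Printing Implicit Defensive.

Definition i0 : 'I_3 := @Ordinal 3 0 isT.
Definition i1 : 'I_3 := @Ordinal 3 1 isT.
Definition i2 : 'I_3 := @Ordinal 3 2 isT.
Definition j0 : 'I_2 := @Ordinal 2 0 isT.
Definition j1 : 'I_2 := @Ordinal 2 1 isT.

Definition vec3 (a b c : R) : 'I_3 -> R :=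
  fun i => match nat_of_ord i with 0%nat => a | 1%nat => b | _ => c end.
Definition vec2 (a b : R) : 'I_2 -> R :=
  fun i => match nat_of_ord i with 0%nat => a | _ => b end.

Local Open Scope R_scope.

Definition dot3 (v w : 'I_3 -> R) : R := v i0 * w i0 + v i1 * w i1 + v i2 * w i2.
Definition norm3 (v : 'I_3 -> R) : R := sqrt (dot3 v v).

Definition shift {n : nat} (v : 'I_n -> R) (i : 'I_n) (s : R) : 'I_n -> R :=
  fun j => if j == i then v j + s else v j.

Definition partial {n : nat} (i : 'I_n) (f : ('I_n -> R) -> R) (v : 'I_n -> R) : R :=
  Derive (fun s => f (shift v i s)) 0.

Definition cont_at {n : nat} (f : ('I_n -> R) -> R) (v : 'I_n -> R) : Prop :=
  forall eps, 0 < eps -> exists delta, 0 < delta /\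
    forall w : 'I_n -> R, (forall j, Rabs (w j - v j) < delta) -> Rabs (f w - f v) < eps.

Fixpoint Ck {n : nat} (k : nat) (U : ('I_n -> R) -> Prop) (f : ('I_n -> R) -> R) : Prop :=
  match k with
  | O => forall v, U v -> cont_at f v
  | S k' => (forall v, U v -> cont_at f v) /\
            forall i : 'I_n, (forall v, U v -> ex_derive (fun s => f (shift v i s)) 0)
                             /\ Ck k' U (partial i f)
  end.

Definition smooth_on {n : nat} (U : ('I_n -> R) -> Prop) (f : ('I_n -> R) -> R) : Prop :=
  forall k, Ck k U f.

Definition smooth_map_on {n m : nat} (U : ('I_n -> R) -> Prop)
  (F : ('I_n -> R) -> ('I_m -> R)) : Prop :=
  forall i : 'I_m, smooth_on U (fun v => F v i).

Definition diffeo_with_inverse {n : nat} (U V : ('I_n -> R) -> Prop)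
  (F G : ('I_n -> R) -> ('I_n -> R)) : Prop :=
  (forall v, U v -> V (F v)) /\ (forall u, V u -> U (G u)) /\
  (forall v, U v -> forall i, G (F v) i = v i) /\
  (forall u, V u -> forall i, F (G u) i = u i) /\
  smooth_map_on U F /\ smooth_map_on V G.

Definition cot (s : R) : R := cos s / sin s.

Definition psi (s : R) : R :=
  if Req_EM_T s 0 then 1 / 3 else (1 - s * cot s) / s ^ 2.

Definition dpsi (s : R) : R := Derive psi s.

Definition norm2 (v : 'I_2 -> R) : R := sqrt (v j0 ^ 2 + v j1 ^ 2).

Definition Lambda (v : 'I_2 -> R) : 'I_2 -> R :=
  let r := norm2 v in
  vec2 (v j1 * (dpsi r / r * v j1 * v j0))
       (v j1 * (dpsi r / r * v j1 * v j1 + 2 * psi r)).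

Definition K3 (v : 'I_2 -> R) : R :=
  let r := norm2 v in 2 * psi r + dpsi r / r * v j1 ^ 2.

(* Omega_{-,4}; theta1 is passed as a parameter (the unique root of tan s = s
   in (pi, 3pi/2), characterized by hypotheses in the theorem) *)
Definition Omega_m4 (theta1 : R) (v : 'I_2 -> R) : Prop :=
  v j1 < 0 /\ PI < v j0 /\ v j0 < norm2 v /\ norm2 v < theta1 /\ K3 v < 0.

Definition R2_lt_plus (u : 'I_2 -> R) : Prop :=
  0 < u j0 /\ 0 < u j1 /\ u j1 < 2 / sqrt PI * sqrt (u j0).

Definition phi (x t tau : 'I_3 -> R) : R :=
  norm3 x ^ 2 * norm3 tau * cot (norm3 tau) + psi (norm3 tau) * (dot3 tau x) ^ 2
  + 4 * dot3 t tau.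

Local Close Scope R_scope.

Local Open Scope ring_scope.

Definition hessian3 (f : ('I_3 -> R) -> R) (th : 'I_3 -> R) : 'M[R]_3 :=
  \matrix_(i < 3, j < 3) partial i (partial j f) th.

Definition eigenvalues_are (A : 'M[R]_3) (s : seq R) : Prop :=
  size s = 3%N /\ char_poly A = \prod_(a <- s) ('X - a%:P).

Definition nonsingular (A : 'M[R]_3) : Prop := \det A != 0.

Definition npos (s : seq R) : nat := count (fun e : R => 0 < e) s.

(* Main.v *)
Require Import Defs.
From Stdlib Require Import Reals Lra Psatz ClassicalEpsilon FunctionalExtensionality.
From Coquelicot Require Import Coquelicot.
From mathcomp Require Import all_boot all_order all_algebra.
From mathcomp Require Import Rstruct.

(** Put [r = |v|], [z = r cot r], [k = v_2^2 / r^2], [a = (r^2 + z^2 + z - 2) / r] and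
[b = 2 (z - 1) / r].  Then [Lambda v = (a k sqrt (1 - k), sqrt k (b - a k))], and [Omega] is
[PI < r < theta1], [0 < k < b / a].  Both [a] and [b^2 / a] decrease in [r].  When the first
coordinate [c] of [Lambda] is prescribed, [k] is a function of [r], and the second coordinate then
decreases strictly in [r], from the limit [2 sqrt c / sqrt PI] at [r = PI] down to [0].  So [Lambda]
is a bijection onto the target, and its inverse is continuous because it is obtained by inverting
two monotone functions of one variable.  By Cramer's rule the partial derivatives of the inverse
are rational expressions in [v] and [z] at the preimage; such expressions are stable under
differentiation, whence smoothness.  Finally the Hessian of [phi] at [theta] is
[- |x|^2 (D Lambda (+) K3)], where [K3 < 0] on [Omega] and [det (D Lambda) < 0], the latter
again because [b^2 / a] decreases. *)

Local Open Scope R_scope.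

(** Since [r^2 psi(r) = 1 - z], for [x = |x| e_1] one has [phi = |x|^2 (1 - psi(|tau|) (tau_2^2 +
    tau_3^2) + <u, tau>)]. On the plane [tau_3 = 0] its gradient is therefore [|x|^2 (u - Lambda)]:
    [theta] is a critical point and the Jacobian of [Lambda] is symmetric. The variable [tau_3]
    enters only through its square, so it splits off in the Hessian. The functions [a] and [b] are
    [r^2 psi'(r)] and [- 2 r psi(r)], and [K3 < 0] reads [a k < b]. Two inequalities make [(r, k)]
    workable. From [2 b < a] comes [k < 1/2], a range where [k^2 (1 - k)] is injective, so that [r]
    and [c] determine [k]. From [b r^2 < a (r^2 - PI^2)] it follows that [PI < v_1] is implied by
    the conditions on [r] and [k]. The obstacle is the edge [r = PI], where [z] is infinite; there
    [a] and [b] are rewritten in [1 / z], and the limit [4 / PI] of [b^2 / a] yields the parabola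
    bounding the target. *)

Definition zc (s : R) : R := s * cot s.
Definition ca (s : R) : R := (s ^ 2 + zc s ^ 2 + zc s - 2) / s.
Definition cb (s : R) : R := 2 * (zc s - 1) / s.

Definition first_tan_fixpoint (th : R) : Prop :=
  PI < th /\ th < 3 / 2 * PI /\ tan th = th.

Lemma decreasing_of_derive_neg (f df : R -> R) (p q : R) : p < q ->
  (forall x, p <= x <= q -> is_derive f x (df x)) ->
  (forall x, p < x < q -> df x < 0) -> f q < f p.
Proof.
move=> pq hf hd.
have [c [hc1 hc2]] := MVT_cor2 f df p q pq
  ltac:(by move=> c hc; apply/is_derive_Reals/hf).
have := hd c hc2; nra.
Qed.

Lemma PI_gt_3 : 3 < PI.
Proof. have := PI2_3_2; lra. Qed.

(** Writing [1 / sin^2] as [1 + cot^2] turns the derivative into a Riccati expression, so the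
    derivatives of [ca] and [cb] are again rational in [s] and [zc s]. *)
Lemma is_derive_zc (s : R) : s <> 0 -> sin s <> 0 ->
  is_derive zc s ((zc s - s ^ 2 - zc s ^ 2) / s).
Proof.
move=> s0 ss; rewrite /zc /cot.
auto_derive=> //.
transitivity (cos s / sin s - s * (sin s ^ 2 + cos s ^ 2) / sin s ^ 2); first by field.
have -> : sin s ^ 2 + cos s ^ 2 = 1 by have := sin2_cos2 s; rewrite /Rsqr; lra.
have -> : (s * (cos s / sin s) - s ^ 2 - (s * (cos s / sin s)) ^ 2) / s =
  cos s / sin s - s * (sin s ^ 2 + cos s ^ 2) / sin s ^ 2 by field.
by have -> : sin s ^ 2 + cos s ^ 2 = 1 by have := sin2_cos2 s; rewrite /Rsqr; lra.
Qed.

Lemma sin_neg_arc (s : R) : PI < s -> s < 3 / 2 * PI -> sin s < 0.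
Proof. by move=> h1 h2; apply: sin_lt_0; have := PI_gt_3; lra. Qed.

Lemma tan_fixpoint_sin_cos (th : R) : first_tan_fixpoint th -> sin th - th * cos th = 0.
Proof.
move=> [h1 [h2 h]].
have c0 : cos th < 0 by apply: cos_lt_0; have := PI_gt_3; lra.
by rewrite -{2}h /tan; field; lra.
Qed.

(** [zc s - 1] equals [(sin s - s cos s) / (- sin s)]. The numerator has derivative [s sin s < 0] on
    the arc and vanishes at [th], because [tan th = th]. *)
Lemma zc_gt1 (th s : R) : first_tan_fixpoint th -> PI < s -> s < th -> 1 < zc s.
Proof.
move=> hth h1 h2; have [h3 [h4 h5]] := hth.
have ss := sin_neg_arc s ltac:(lra) ltac:(lra).
have pp : 0 < sin s - s * cos s.
  rewrite -(tan_fixpoint_sin_cos th hth).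
  apply: (decreasing_of_derive_neg (fun t => sin t - t * cos t) (fun t => t * sin t)) => //.
    by move=> t _; auto_derive=> //; ring.
  by move=> t ht; have := sin_neg_arc t ltac:(lra) ltac:(lra); have := PI_gt_3; nra.
rewrite /zc /cot.
have -> : s * (cos s / sin s) = 1 + (sin s - s * cos s) / (- sin s) by field; lra.
have : 0 < (sin s - s * cos s) / (- sin s) by apply: Rdiv_lt_0_compat; lra.
lra.
Qed.

Lemma zc_theta (th : R) : first_tan_fixpoint th -> zc th = 1.
Proof.
move=> hth; have [h3 [h4 h5]] := hth.
have ss := sin_neg_arc th h3 h4.
have h := tan_fixpoint_sin_cos th hth.
rewrite /zc /cot Rmult_div_assoc.
have -> : th * cos th = sin th by lra.
by field; lra.
Qed.

Lemma zc_ge1 (th s : R) : first_tan_fixpoint th -> PI < s -> s <= th -> 1 <= zc s.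
Proof.
move=> hth h1 [h2|->]; last by rewrite zc_theta //; lra.
by have := zc_gt1 th s hth h1 h2; lra.
Qed.

Lemma ca_gt0 (s : R) : PI < s -> 1 <= zc s -> 0 < ca s.
Proof.
move=> h1 h2; apply: Rdiv_lt_0_compat; have := PI_gt_3; nra.
Qed.

Lemma cb_ge0 (s : R) : PI < s -> 1 <= zc s -> 0 <= cb s.
Proof.
move=> h1 h2; rewrite /cb.
apply: Rmult_le_pos; [lra | left; apply: Rinv_0_lt_compat; have := PI_gt_3; lra].
Qed.

Lemma cb_gt0 (s : R) : PI < s -> 1 < zc s -> 0 < cb s.
Proof.
by move=> h1 h2; apply: Rdiv_lt_0_compat; have := PI_gt_3; lra.
Qed.

Lemma double_cb_lt_ca (s : R) : PI < s -> 2 * cb s < ca s.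
Proof.
move=> h1; have p3 := PI_gt_3.
have : 0 < ca s - 2 * cb s; last lra.
have -> : ca s - 2 * cb s = (s ^ 2 + zc s ^ 2 - 3 * zc s + 2) / s.
  by rewrite /ca /cb; field; lra.
by apply: Rdiv_lt_0_compat; [have := pow2_ge_0 (zc s - 3 / 2); nra | lra].
Qed.

Lemma cos_PI_add (y : R) : cos (PI + y) = - cos y.
Proof. by rewrite Rplus_comm neg_cos. Qed.
Lemma sin_PI_add (y : R) : sin (PI + y) = - sin y.
Proof. by rewrite Rplus_comm neg_sin. Qed.

(** At the edge [k = b / a] this says [PI^2 < r^2 (1 - k) = v_1^2], and a smaller [k] only increases
    [v_1]. *)
Lemma cb_ca_radius (s : R) : PI < s -> s < 3 / 2 * PI -> 1 <= zc s ->
  cb s * s ^ 2 < ca s * (s ^ 2 - PI ^ 2).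
Proof.
move=> h1 h2 hz; have p3 := PI_gt_3.
pose y := s - PI.
have sE : s = PI + y by rewrite /y; ring.
have sy : sin s = - sin y by rewrite sE sin_PI_add.
have cy : cos s = - cos y by rewrite sE cos_PI_add.
have hy : 0 < y < PI / 2 by rewrite /y; lra.
have siny : 0 < sin y by apply: sin_gt_0; lra.
have cosy : 0 < cos y by apply: cos_gt_0; lra.
have cosy1 : cos y <= 1 by have := COS_bound y; lra.
have sinlt : sin y < y by apply: sin_lt_x; lra.
have zE : zc s * sin y = s * cos y.
  by rewrite /zc /cot sy cy; field; lra.
have NE : (s ^ 2 + zc s ^ 2) * sin y ^ 2 = s ^ 2.
  have e2 : sin y ^ 2 + cos y ^ 2 = 1 by have := sin2_cos2 y; rewrite /Rsqr; lra.
  by rewrite Rmult_plus_distr_r -(Rpow_mult_distr (zc s)) zE Rpow_mult_distr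
    -Rmult_plus_distr_l e2 Rmult_1_r.
set z := zc s in hz zE NE *.
have goal' : 0 < (s ^ 2 + z ^ 2 + z - 2) * (s ^ 2 - PI ^ 2) - 2 * (z - 1) * s ^ 2.
  (* Multiplied by [sin y ^ 2 / s ^ 2] this becomes [2 s (y - sin y cos y) - y^2 + sin^2 y >= 0],
     and since [cos y <= 1] it follows from [(2 s - y - sin y) (y - sin y) >= 0]. *)
  have key : (s ^ 2 + z ^ 2) * (s ^ 2 - PI ^ 2) - 2 * z * s ^ 2 + 2 * s ^ 2 >= s ^ 2.
    have sp : 0 < sin y ^ 2 by nra.
    apply: Rle_ge; apply: (Rmult_le_reg_r _ _ _ sp).
    have -> : ((s ^ 2 + z ^ 2) * (s ^ 2 - PI ^ 2) - 2 * z * s ^ 2 + 2 * s ^ 2) * sin y ^ 2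
      = s ^ 2 * (2 * s * y - y ^ 2) - 2 * s ^ 2 * sin y * (z * sin y) + 2 * s ^ 2 * sin y ^ 2.
      transitivity (((s ^ 2 + z ^ 2) * sin y ^ 2) * (s ^ 2 - PI ^ 2)
        - 2 * s ^ 2 * sin y * (z * sin y) + 2 * s ^ 2 * sin y ^ 2); first by ring.
      by rewrite NE /y; ring.
    rewrite zE.
    have -> : s ^ 2 * (2 * s * y - y ^ 2) - 2 * s ^ 2 * sin y * (s * cos y) + 2 * s ^ 2 * sin y ^ 2
       = s ^ 2 * (2 * s * (y - sin y * cos y) - y ^ 2 + 2 * sin y ^ 2) by ring.
    apply: Rmult_le_compat_l; first nra.
    have h : sin y * cos y <= sin y by nra.
    have : 0 <= 2 * s * (sin y - sin y * cos y) by nra.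
    have : 0 <= (2 * s - y - sin y) * (y - sin y) by nra.
    lra.
  have : 0 <= (z - 1) * (s ^ 2 - PI ^ 2) by apply: Rmult_le_pos; nra.
  have : 0 < PI ^ 2 by nra.
  lra.
rewrite /ca /cb -/z.
have hs : 0 < / s by apply: Rinv_0_lt_compat; lra.
rewrite /Rdiv; nra.
Qed.

Lemma is_derive_ca (s : R) : s <> 0 -> sin s <> 0 ->
  is_derive ca s ((2 - 2 * zc s * s ^ 2 - 2 * zc s ^ 3) / s ^ 2).
Proof.
move=> s0 ss; have dz := is_derive_zc s s0 ss.
rewrite /ca.
have hD : Derive (fun x => zc x) s = (zc s - s ^ 2 - zc s ^ 2) / s by exact: is_derive_unique.
by auto_derive; [repeat split=> //; exists ((zc s - s ^ 2 - zc s ^ 2) / s) | rewrite hD; field].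
Qed.

Lemma is_derive_cb (s : R) : s <> 0 -> sin s <> 0 ->
  is_derive cb s (2 * (1 - s ^ 2 - zc s ^ 2) / s ^ 2).
Proof.
move=> s0 ss; have dz := is_derive_zc s s0 ss.
rewrite /cb.
have hD : Derive (fun x => zc x) s = (zc s - s ^ 2 - zc s ^ 2) / s by exact: is_derive_unique.
by auto_derive; [repeat split=> //; exists ((zc s - s ^ 2 - zc s ^ 2) / s) | rewrite hD; field].
Qed.

Lemma ca_decr (th r s : R) : first_tan_fixpoint th -> PI < r -> r < s -> s <= th -> ca s < ca r.
Proof.
move=> hth h1 h2 h3; have p3 := PI_gt_3; have [h4 [h5 _]] := hth.
apply: (decreasing_of_derive_neg ca (fun s => (2 - 2 * zc s * s ^ 2 - 2 * zc s ^ 3) / s ^ 2)) => //.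
  by move=> x hx; apply: is_derive_ca; [lra | have := sin_neg_arc x; lra].
move=> x hx; have hz := zc_gt1 th x hth ltac:(lra) ltac:(lra).
have : 0 < (2 * zc x * x ^ 2 + 2 * zc x ^ 3 - 2) / x ^ 2.
    have : 0 < zc x ^ 3 by apply: pow_lt; lra.
    by have : 9 < x ^ 2 by [nra]; move=> ? ?; apply: Rdiv_lt_0_compat; nra.
rewrite /Rdiv; lra.
Qed.

(* With [N = s^2 + z^2] the claim is [N (3 - 2 z - s^2) < 1]. *)
Lemma cb2_ca_derive_neg (s : R) : PI < s -> 1 <= zc s ->
  2 * (2 * (1 - s ^ 2 - zc s ^ 2) / s ^ 2) * ca s
    < cb s * ((2 - 2 * zc s * s ^ 2 - 2 * zc s ^ 3) / s ^ 2).
Proof.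
move=> h1 hz; have p3 := PI_gt_3.
have s0 : s <> 0 by lra.
rewrite /ca /cb; set z := zc s in hz *.
have : 0 < 4 * (1 - (s ^ 2 + z ^ 2) * (3 - 2 * z - s ^ 2)) / s ^ 3.
  have : (s ^ 2 + z ^ 2) * (3 - 2 * z - s ^ 2) < 0.
    have h : 0 < s ^ 2 + z ^ 2 by nra.
    have : 3 - 2 * z - s ^ 2 < 0 by nra.
    by nra.
  by move=> ?; apply: Rdiv_lt_0_compat; [lra | apply: pow_lt; lra].
suff -> : 4 * (1 - (s ^ 2 + z ^ 2) * (3 - 2 * z - s ^ 2)) / s ^ 3 =
  2 * (z - 1) / s * ((2 - 2 * z * s ^ 2 - 2 * z ^ 3) / s ^ 2) -
  2 * (2 * (1 - s ^ 2 - z ^ 2) / s ^ 2) * ((s ^ 2 + z ^ 2 + z - 2) / s) by lra.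
by field.
Qed.

Lemma cb2_div_ca_decr (th r s : R) : first_tan_fixpoint th -> PI < r -> r < s -> s < th ->
  cb s ^ 2 / ca s < cb r ^ 2 / ca r.
Proof.
move=> hth h1 h2 h3; have p3 := PI_gt_3; have [h4 [h5 _]] := hth.
pose db s := 2 * (1 - s ^ 2 - zc s ^ 2) / s ^ 2.
pose da s := (2 - 2 * zc s * s ^ 2 - 2 * zc s ^ 3) / s ^ 2.
have hp x : PI < x -> x < th -> 0 < ca x.
  by move=> *; apply: ca_gt0; [lra | apply: (zc_ge1 th)=> //; lra].
apply: (decreasing_of_derive_neg (fun s => cb s ^ 2 / ca s)
  (fun s => (cb s * (2 * db s * ca s - cb s * da s)) / ca s ^ 2)) => //.
  move=> x hx; have ss : sin x <> 0 by have := sin_neg_arc x; lra.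
  have e1 := is_derive_ca x ltac:(lra) ss; have e2 := is_derive_cb x ltac:(lra) ss.
  have cx := hp x ltac:(lra) ltac:(lra).
  have u1 : Derive (fun x => ca x) x = da x by apply: is_derive_unique.
  have u2 : Derive (fun x => cb x) x = db x by apply: is_derive_unique.
  auto_derive; first by repeat split; [exists (db x) | exists (da x) | lra].
  by rewrite u1 u2; field; lra.
move=> x hx; have hz := zc_gt1 th x hth ltac:(lra) ltac:(lra).
have cx := hp x ltac:(lra) ltac:(lra).
have bx := cb_gt0 x ltac:(lra) hz.
have := cb2_ca_derive_neg x ltac:(lra) ltac:(lra); rewrite -/(db x) -/(da x) => hk.
have : 0 < (cb x * (cb x * da x - 2 * db x * ca x)) / ca x ^ 2.
  apply: Rdiv_lt_0_compat; last nra.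
  by apply: Rmult_lt_0_compat; lra.
rewrite /Rdiv; lra.
Qed.

(** * Continuity of an implicitly defined function *)

Lemma continuous_of_derive (f : R -> R) (x : R) : ex_derive f x -> continuous f x.
Proof. exact: ex_derive_continuous. Qed.

Lemma continuity_pt_of_derive (f : R -> R) (x : R) : ex_derive f x -> continuity_pt f x.
Proof. by move=> h; apply/continuity_pt_filterlim; apply: continuous_of_derive. Qed.

(** [F p] changes sign exactly at [g p], so its signs at the two fixed points [g p0 - e] and
    [g p0 + e] trap [g p] between them. Only continuity in [p], for one [x] at a time, enters. *)
Lemma continuous_of_sign_change (T : UniformSpace) (F : T -> R -> R) (g : T -> R) (p0 : T) (e0 : R) :
  0 < e0 ->
  (forall x, Rabs (x - g p0) <= e0 -> continuous (fun p => F p x) p0) ->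
  locally p0 (fun p => forall x, Rabs (x - g p0) <= e0 ->
    (0 < F p x <-> x < g p) /\ (F p x < 0 <-> g p < x)) ->
  continuous g p0.
Proof.
move=> e00 hc hl; apply/filterlim_locally => eps.
pose e := Rmin e0 (eps / 2).
have ep := cond_pos eps.
have ee : 0 < e /\ e <= e0 /\ e < eps.
  split; first by apply: Rmin_pos; lra.
  by split; [apply: Rmin_l | apply: Rle_lt_trans (Rmin_r _ _) _; lra].
have x1 : Rabs (g p0 - e - g p0) <= e0 by rewrite Rabs_left; lra.
have x2 : Rabs (g p0 + e - g p0) <= e0 by rewrite Rabs_right; lra.
have h0 := locally_singleton _ _ hl.
have [[_ l1] _] := h0 _ x1; have [_ [_ l2]] := h0 _ x2.
have {}l1 := l1 ltac:(lra); have {}l2 := l2 ltac:(lra).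
have o1 := hc _ x1 _ (open_gt 0 _ l1); have o2 := hc _ x2 _ (open_lt 0 _ l2).
rewrite /filtermap in o1 o2.
apply: filter_imp (filter_and _ _ hl (filter_and _ _ o1 o2)) => p [hp [p1 p2]].
have [[q1 _] _] := hp _ x1; have [_ [q2 _]] := hp _ x2.
have {}q1 := q1 p1; have {}q2 := q2 p2.
change (Rabs (g p - g p0) < eps).
by apply: Rabs_def1; lra.
Qed.

(** * The cubic [k^2 (1 - k)], its inverse, and the comparison of two points with equal first
    coordinate *)

Lemma cubic_incr (k l : R) : 0 <= k -> k < l -> l <= 1 / 2 -> k ^ 2 * (1 - k) < l ^ 2 * (1 - l).
Proof.
move=> h1 h2 h3.
have : 0 < (l - k) * ((l + k) - (l ^ 2 + l * k + k ^ 2)) by apply: Rmult_lt_0_compat; nra.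
lra.
Qed.

Lemma cubic_inj (k l : R) : 0 <= k <= 1 / 2 -> 0 <= l <= 1 / 2 ->
  k ^ 2 * (1 - k) = l ^ 2 * (1 - l) -> k = l.
Proof.
move=> hk hl h; case: (Rtotal_order k l) => [h1|[//|h1]].
  by have := cubic_incr k l; lra.
by have := cubic_incr l k; lra.
Qed.

(** Inverse of the cubic on [[0, 1/2]], meaningful up to its value [1/8] at [1/2]. The equation
    [a k sqrt (1 - k) = c] is solved by taking [p = c^2 / a^2]. *)
Definition kap (p : R) : R :=
  ClassicalEpsilon.epsilon (inhabits 0) (fun k => 0 <= k <= 1 / 2 /\ k ^ 2 * (1 - k) = p).

Lemma kap_spec (p : R) : 0 < p -> p < 1 / 8 ->
  0 < kap p < 1 / 2 /\ kap p ^ 2 * (1 - kap p) = p.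
Proof.
move=> h1 h2.
have [h3 h4] : 0 <= kap p <= 1 / 2 /\ kap p ^ 2 * (1 - kap p) = p.
  apply: (ClassicalEpsilon.epsilon_spec (inhabits 0) (fun k => 0 <= k <= 1 / 2 /\ k ^ 2 * (1 - k) = p)).
  have hc a : 0 <= a <= 1 / 2 -> continuity_pt (fun k => k ^ 2 * (1 - k) - p) a.
    by move=> _; apply: continuity_pt_of_derive; auto_derive.
  have [k [hk hk2]] := Ranalysis5.IVT_interv (fun k => k ^ 2 * (1 - k) - p) 0 (1 / 2) hc
    ltac:(lra) ltac:(lra) ltac:(lra).
  by exists k; split=> //; lra.
split=> //; split.
  by case: h3 => [[//|h] _]; rewrite -h in h4; lra.
by case: h3 => [_ [//|h]]; rewrite h in h4; lra.
Qed.

Lemma kap_unique (k : R) : 0 < k -> k < 1 / 2 -> kap (k ^ 2 * (1 - k)) = k.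
Proof.
move=> h1 h2; have p1 := cubic_incr 0 k ltac:(lra) h1 ltac:(lra).
have p2 := cubic_incr k (1 / 2) ltac:(lra) h2 ltac:(lra).
have [h3 h4] := kap_spec (k ^ 2 * (1 - k)) ltac:(lra) ltac:(lra).
by apply: cubic_inj => //; lra.
Qed.

Lemma continuous_kap (p : R) : 0 < p -> p < 1 / 8 -> continuous kap p.
Proof.
move=> h1 h2; have [h3 h4] := kap_spec p h1 h2.
apply: (continuous_of_sign_change _ (fun p k => p - k ^ 2 * (1 - k)) kap p
  (Rmin (kap p) (1 / 2 - kap p))).
- by apply: Rmin_pos; lra.
- by move=> x _; apply: continuous_of_derive; auto_derive.
have l : locally p (fun q => 0 < q /\ q < 1 / 8).
  by apply: filter_and; [exact: (open_gt 0) | exact: (open_lt (1 / 8))].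
apply: filter_imp l => q [q1 q2] x hx.
have [h5 h6] := kap_spec q q1 q2.
have hx2 : 0 <= x <= 1 / 2.
  have := Rabs_le_between (x - kap p) (Rmin (kap p) (1 / 2 - kap p)).
  have := Rmin_l (kap p) (1 / 2 - kap p); have := Rmin_r (kap p) (1 / 2 - kap p).
  by move=> ? ? [/(_ hx)] ? _; lra.
case: (Rtotal_order x (kap q)) => [h|[h|h]].
- by have := cubic_incr x (kap q); lra.
- by rewrite h; lra.
- by have := cubic_incr (kap q) x; lra.
Qed.

(* Writing [m_i = (1 - k_i)^(-1/4)], [w_i = sqrt k_i / sqrt (1 - k_i)] and [c] for the common value
   of [a_i k_i sqrt (1 - k_i)], the two sides are [sqrt c (b_i / sqrt a_i) m_i - c w_i],
   and [m_i^4 = 1 + w_i^2] compares [m_2 - m_1] with [w_2 - w_1]. *)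
Lemma second_coord_decr (a1 b1 a2 b2 k1 k2 : R) :
  0 < a2 -> a2 < a1 -> 0 < b1 -> 0 < b2 -> 2 * b2 < a2 -> b2 ^ 2 / a2 < b1 ^ 2 / a1 ->
  0 < k1 < 1 / 2 -> 0 < k2 < 1 / 2 ->
  a1 * k1 * sqrt (1 - k1) = a2 * k2 * sqrt (1 - k2) ->
  sqrt k2 * (b2 - a2 * k2) < sqrt k1 * (b1 - a1 * k1).
Proof.
move=> a20 a12 b10 b20 hb2 hbeta hk1 hk2 hc.
pose r k := sqrt k; pose y k := sqrt (1 - k); pose s k := sqrt (y k).
have rP k : 0 < k < 1 / 2 -> 0 < r k /\ r k ^ 2 = k.
  by move=> hk; split; [apply: sqrt_lt_R0; lra | apply: pow2_sqrt; lra].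
have yP k : 0 < k < 1 / 2 -> 0 < y k /\ y k ^ 2 = 1 - k.
  by move=> hk; split; [apply: sqrt_lt_R0; lra | apply: pow2_sqrt; lra].
have sP k : 0 < k < 1 / 2 -> 0 < s k /\ s k ^ 2 = y k.
  by move=> /yP hk; split; [apply: sqrt_lt_R0; lra | apply: pow2_sqrt; lra].
have [r1 r1E] := rP _ hk1; have [r2 r2E] := rP _ hk2.
have [y1 y1E] := yP _ hk1; have [y2 y2E] := yP _ hk2.
have [s1 s1E] := sP _ hk1; have [s2 s2E] := sP _ hk2.
rewrite -/(r k1) -/(r k2); rewrite -/(y k1) -/(y k2) in hc.
set u1 := r k1 in r1 r1E *; set u2 := r k2 in r2 r2E *.
set x1 := y k1 in y1 y1E s1E hc *; set x2 := y k2 in y2 y2E s2E hc *.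
set t1 := s k1 in s1 s1E *; set t2 := s k2 in s2 s2E *.
clearbody u1 u2 x1 x2 t1 t2; clear rP yP sP r y s.
have a10 : 0 < a1 by lra.
(* If [k2 <= k1], the cubic gives [k2 x2 <= k1 x1], and [a2 < a1] then contradicts the equality of
   the first coordinates. *)
have k12 : k1 < k2.
  case: (Rlt_le_dec k1 k2) => // h.
  have : k2 ^ 2 * (1 - k2) <= k1 ^ 2 * (1 - k1).
    by case: h => [h|->]; [left; apply: cubic_incr; lra | right].
  rewrite -y1E -y2E => h2.
  have h3 : a2 * (k2 * x2) < a1 * (k1 * x1).
    have : k2 * x2 <= k1 * x1.
      by apply: Rsqr_incr_0_var; rewrite ?/Rsqr; nra.
    have : 0 < k1 * x1 by nra.
    nra.
  lra.
pose c := a2 * k2 * x2.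
have c0 : 0 < c by rewrite /c; apply: Rmult_lt_0_compat => //; apply: Rmult_lt_0_compat; lra.
have cE1 : c = a1 * u1 ^ 2 * t1 ^ 2 by rewrite r1E s1E /c hc.
have cE2 : c = a2 * u2 ^ 2 * t2 ^ 2 by rewrite r2E s2E.
pose e := sqrt c.
have [e0 eE] : 0 < e /\ e ^ 2 = c by split; [exact: sqrt_lt_R0 | apply: pow2_sqrt; lra].
pose g1 := b1 / sqrt a1; pose g2 := b2 / sqrt a2.
have [f10 f1E] : 0 < sqrt a1 /\ sqrt a1 ^ 2 = a1 by split; [exact: sqrt_lt_R0 | apply: pow2_sqrt; lra].
have [f20 f2E] : 0 < sqrt a2 /\ sqrt a2 ^ 2 = a2 by split; [exact: sqrt_lt_R0 | apply: pow2_sqrt; lra].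
have e1 : e = sqrt a1 * u1 * t1.
  apply: (Rsqr_inj _ _ (Rlt_le _ _ e0)).
    by apply: Rmult_le_pos; [apply: Rmult_le_pos |]; lra.
  by rewrite !Rsqr_pow2 eE !Rpow_mult_distr f1E.
have e2 : e = sqrt a2 * u2 * t2.
  apply: (Rsqr_inj _ _ (Rlt_le _ _ e0)).
    by apply: Rmult_le_pos; [apply: Rmult_le_pos |]; lra.
  by rewrite !Rsqr_pow2 eE !Rpow_mult_distr f2E.
pose m1 := / t1; pose m2 := / t2.
pose w1 := u1 / t1 ^ 2; pose w2 := u2 / t2 ^ 2.
have H1 : u1 * (b1 - a1 * k1) = e * g1 * m1 - c * w1.
  rewrite cE1 e1 /g1 /m1 /w1 -r1E; field; lra.
have H2 : u2 * (b2 - a2 * k2) = e * g2 * m2 - c * w2.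
  by rewrite cE2 e2 /g2 /m2 /w2 -r2E; field; lra.
have g12 : g2 < g1.
  apply: Rsqr_incrst_0; last 2 first.
  - by left; apply: Rdiv_lt_0_compat.
  - by left; apply: Rdiv_lt_0_compat.
  by rewrite !Rsqr_pow2 /g1 /g2 /Rdiv !Rpow_mult_distr !pow_inv f1E f2E.
have m10 : 0 < m1 by apply: Rinv_0_lt_compat.
have m20 : 0 < m2 by apply: Rinv_0_lt_compat.
have w10 : 0 < w1 by apply: Rdiv_lt_0_compat => //; apply: pow_lt.
have w20 : 0 < w2 by apply: Rdiv_lt_0_compat => //; apply: pow_lt.
have m1E : m1 ^ 4 = 1 + w1 ^ 2.
  have : t1 ^ 4 = 1 - u1 ^ 2 by rewrite r1E -y1E -s1E; ring.
  move=> h; rewrite /m1 /w1; have -> : 1 + (u1 / t1 ^ 2) ^ 2 = (t1 ^ 4 + u1 ^ 2) / t1 ^ 4 by field; lra.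
  by rewrite (_ : t1 ^ 4 + u1 ^ 2 = 1); [field; lra | lra].
have m2E : m2 ^ 4 = 1 + w2 ^ 2.
  have : t2 ^ 4 = 1 - u2 ^ 2 by rewrite r2E -y2E -s2E; ring.
  move=> h; rewrite /m2 /w2; have -> : 1 + (u2 / t2 ^ 2) ^ 2 = (t2 ^ 4 + u2 ^ 2) / t2 ^ 4 by field; lra.
  by rewrite (_ : t2 ^ 4 + u2 ^ 2 = 1); [field; lra | lra].
have t12 : t2 < t1.
  have h : x2 < x1 by nra.
  nra.
have m12 : m1 < m2 by apply: Rinv_lt_contravar => //; nra.
have w12 : w1 < w2.
  have : w1 ^ 2 < w2 ^ 2.
    have : m1 ^ 4 < m2 ^ 4 by have : m1 ^ 2 < m2 ^ 2 by [nra]; nra.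
    lra.
  nra.
have m1_ge : 1 < m1.
  have : 1 < m1 ^ 2 by have : 0 < w1 ^ 2 by [nra]; nra.
  nra.
have w2E : w2 = u2 * m2 ^ 2 by rewrite /w2 /m2; field; lra.
have e3 : e * m2 = sqrt a2 * u2 by rewrite e2 /m2; field; lra.
have g2E : g2 * sqrt a2 = b2 by rewrite /g2; field; lra.
have m2_le : m2 ^ 3 < 2.
  have : t2 ^ 4 > 1 / 2.
    have -> : t2 ^ 4 = 1 - k2 by rewrite -y2E -s2E; ring.
    lra.
  have : m2 ^ 4 * t2 ^ 4 = 1 by rewrite /m2; field; lra.
  have : 1 < m2 by lra.
  have : 0 < m2 ^ 3 by apply: pow_lt.
  have -> : m2 ^ 4 = m2 ^ 3 * m2 by ring.
  nra.
(* This is [prod] below, multiplied by [(m1 + m2) (m1^2 + m2^2)], which turns [m2 - m1] into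
   [m2^4 - m1^4 = w2^2 - w1^2], and divided by [e (w2 - w1)]. The left side is below [2 g2 w2] and
   the right side is at least [4 e]. The remaining [g2 w2 < 2 e] amounts to [b2 m2^3 < 2 a2], which
   holds by [2 b2 < a2] and [m2^3 < 2]. *)
have key : g2 * (w1 + w2) < e * ((m1 + m2) * (m1 ^ 2 + m2 ^ 2)).
  have g20 : 0 < g2 by apply: Rdiv_lt_0_compat.
  apply: (Rlt_trans _ (g2 * (2 * w2))); first by apply: Rmult_lt_compat_l; lra.
  apply: (Rlt_le_trans _ (e * 4)); last by apply: Rmult_le_compat_l; nra.
  apply: (Rmult_lt_reg_r (m2 * sqrt a2)); first by nra.
  have -> : g2 * (2 * w2) * (m2 * sqrt a2) = (2 * b2) * u2 * m2 ^ 3 by rewrite -g2E w2E; ring.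
  have -> : e * 4 * (m2 * sqrt a2) = 4 * a2 * u2.
    by rewrite -{2}f2E; transitivity (4 * (e * m2) * sqrt a2); [ring | rewrite e3; ring].
  have : b2 * m2 ^ 3 < b2 * 2 by apply: Rmult_lt_compat_l.
  nra.
have prod : e * g2 * (m2 - m1) < c * (w2 - w1).
  have P : 0 < (m1 + m2) * (m1 ^ 2 + m2 ^ 2) by nra.
  apply: (Rmult_lt_reg_r _ _ _ P).
  have -> : e * g2 * (m2 - m1) * ((m1 + m2) * (m1 ^ 2 + m2 ^ 2)) = e * g2 * (m2 ^ 4 - m1 ^ 4) by ring.
  rewrite m1E m2E -eE.
  have -> : e * g2 * (1 + w2 ^ 2 - (1 + w1 ^ 2)) = (e * (w2 - w1)) * (g2 * (w1 + w2)) by ring.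
  have -> : e ^ 2 * (w2 - w1) * ((m1 + m2) * (m1 ^ 2 + m2 ^ 2)) =
    (e * (w2 - w1)) * (e * ((m1 + m2) * (m1 ^ 2 + m2 ^ 2))) by ring.
  by apply: Rmult_lt_compat_l => //; apply: Rmult_lt_0_compat; lra.
rewrite H1 H2.
have : e * g2 * m1 < e * g1 * m1 by apply: Rmult_lt_compat_r => //; apply: Rmult_lt_compat_l.
lra.
Qed.

(** * The level sets of the first coordinate *)

(** The value of [k] forced at radius [r] by the first coordinate [c]; [height] is the second
    coordinate there. Both are meaningful where [c ^ 2 / ca r ^ 2 < 1 / 8], which is solvability
    with [0 < k < 1/2]. *)
Definition angle (r c : R) : R := kap (c ^ 2 / ca r ^ 2).
Definition height (r c : R) : R := sqrt (angle r c) * (cb r - ca r * angle r c).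

Lemma angle_spec (r c : R) : 0 < c -> 0 < ca r -> c ^ 2 / ca r ^ 2 < 1 / 8 ->
  0 < angle r c < 1 / 2 /\ ca r * angle r c * sqrt (1 - angle r c) = c.
Proof.
move=> c0 a0 h.
have p0 : 0 < c ^ 2 / ca r ^ 2 by apply: Rdiv_lt_0_compat; apply: pow_lt.
have [h1 h2] := kap_spec _ p0 h.
split=> //; rewrite -/(angle r c) in h1 h2.
set A := ca r in a0 h p0 h1 h2 *; set k := angle r c in h1 h2 *; clearbody A k.
have s0 : 0 < sqrt (1 - k) by apply: sqrt_lt_R0; lra.
apply: Rsqr_inj; first by apply: Rmult_le_pos; [apply: Rmult_le_pos |]; lra.
  lra.
rewrite !Rsqr_pow2 !Rpow_mult_distr pow2_sqrt; last lra.
by rewrite Rmult_assoc h2; field; lra.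
Qed.

Lemma angle_unique (r c k : R) : 0 < ca r -> 0 < k -> k < 1 / 2 ->
  ca r * k * sqrt (1 - k) = c -> c ^ 2 / ca r ^ 2 < 1 / 8 /\ angle r c = k.
Proof.
set A := ca r => a0 k0 k1 hc.
have e : c ^ 2 / A ^ 2 = k ^ 2 * (1 - k).
  rewrite -hc; clearbody A; rewrite !Rpow_mult_distr pow2_sqrt; last lra.
  by field; lra.
rewrite /angle -/A e; split; last exact: kap_unique.
by have := cubic_incr k (1 / 2); lra.
Qed.

(** As [ca] decreases, the radii carrying a given [c] form an interval starting at [PI], so
    monotonicity and intermediate values are available between any two of them. *)
Lemma admissible_left (th r s c : R) : first_tan_fixpoint th -> 0 < c ->
  PI < r -> r < s -> s <= th -> c ^ 2 / ca s ^ 2 < 1 / 8 -> c ^ 2 / ca r ^ 2 < 1 / 8.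
Proof.
move=> hth c0 h1 h2 h3; apply: Rle_lt_trans.
have a1 := ca_decr th r s hth h1 h2 h3.
have a2 : 0 < ca s by apply: ca_gt0; [lra | apply: (zc_ge1 th)=> //; lra].
apply: Rmult_le_compat_l; first nra.
by apply: Rinv_le_contravar; nra.
Qed.

Lemma height_decr (th r s c : R) : first_tan_fixpoint th -> 0 < c ->
  PI < r -> r < s -> s < th -> c ^ 2 / ca s ^ 2 < 1 / 8 -> height s c < height r c.
Proof.
move=> hth c0 h1 h2 h3 h4.
have h5 := admissible_left th r s c hth c0 h1 h2 (Rlt_le _ _ h3) h4.
have zr : 1 < zc r by apply: (zc_gt1 th)=> //; lra.
have zs : 1 < zc s by apply: (zc_gt1 th)=> //; lra.
have ar : 0 < ca r by apply: ca_gt0; lra.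
have as_ : 0 < ca s by apply: ca_gt0; lra.
have [k1 e1] := angle_spec r c c0 ar h5.
have [k2 e2] := angle_spec s c c0 as_ h4.
apply: second_coord_decr => //.
- by apply: (ca_decr th)=> //; lra.
- by apply: cb_gt0; lra.
- by apply: cb_gt0; lra.
- by apply: double_cb_lt_ca; lra.
- exact: (cb2_div_ca_decr th).
- by rewrite e1 e2.
Qed.

Lemma sin_neq0_arc (s : R) : PI < s -> s < 3 / 2 * PI -> sin s <> 0.
Proof. by move=> h1 h2; have := sin_neg_arc s h1 h2; lra. Qed.

Lemma continuous_ca (s : R) : PI < s -> s < 3 / 2 * PI -> continuous ca s.
Proof.
move=> h1 h2; have p3 := PI_gt_3; apply: continuous_of_derive; eexists; apply: is_derive_ca.
  lra.
exact: sin_neq0_arc.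
Qed.

Lemma continuous_cb (s : R) : PI < s -> s < 3 / 2 * PI -> continuous cb s.
Proof.
move=> h1 h2; have p3 := PI_gt_3; apply: continuous_of_derive; eexists; apply: is_derive_cb.
  lra.
exact: sin_neq0_arc.
Qed.

Lemma continuous_div (T : UniformSpace) (f g : T -> R) (x : T) :
  continuous f x -> continuous g x -> g x <> 0 -> continuous (fun t => f t / g t) x.
Proof.
move=> hf hg h; apply: (continuous_mult f) => //.
apply: (continuous_comp g Rinv) => //.
by apply: continuous_of_derive; auto_derive.
Qed.

Lemma continuous_pow (T : UniformSpace) (f : T -> R) (n : nat) (x : T) :
  continuous f x -> continuous (fun t => f t ^ n) x.
Proof.
by move=> hf; apply: (continuous_comp f (fun y => y ^ n)) => //;
  apply: continuous_of_derive; auto_derive.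
Qed.

Lemma continuous_angle (T : UniformSpace) (r c : T -> R) (x : T) :
  continuous r x -> continuous c x -> PI < r x -> r x < 3 / 2 * PI -> 0 < c x -> 0 < ca (r x) ->
  c x ^ 2 / ca (r x) ^ 2 < 1 / 8 -> continuous (fun t => angle (r t) (c t)) x.
Proof.
move=> cr cc h1 h2 c0 a0 h3.
have c1 : continuous (fun t => ca (r t)) x by apply: (continuous_comp r ca)=> //; exact: continuous_ca.
apply: (continuous_comp (fun t => c t ^ 2 / ca (r t) ^ 2) kap).
  apply: continuous_div; [exact: continuous_pow | exact: continuous_pow | nra].
by apply: continuous_kap=> //; apply: Rdiv_lt_0_compat; apply: pow_lt.
Qed.

Lemma continuous_height (T : UniformSpace) (r c : T -> R) (x : T) :
  continuous r x -> continuous c x -> PI < r x -> r x < 3 / 2 * PI -> 0 < c x -> 0 < ca (r x) ->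
  c x ^ 2 / ca (r x) ^ 2 < 1 / 8 -> continuous (fun t => height (r t) (c t)) x.
Proof.
move=> cr cc h1 h2 c0 a0 h3.
have c1 : continuous (fun t => ca (r t)) x by apply: (continuous_comp r ca)=> //; exact: continuous_ca.
have c2 : continuous (fun t => cb (r t)) x by apply: (continuous_comp r cb)=> //; exact: continuous_cb.
have c3 := continuous_angle T r c x cr cc h1 h2 c0 a0 h3.
apply: (continuous_mult (fun t => sqrt (angle (r t) (c t)))).
  exact: (continuous_comp _ sqrt _ c3 (continuous_sqrt _)).
by apply: (continuous_minus (fun t => cb (r t))) => //; apply: (continuous_mult (fun t => ca (r t))).
Qed.

(** * Behaviour at the edge [r = PI] and the values taken by the height *)

Lemma pick_right_of (p q : R) (P : R -> Prop) : p < q -> locally p P -> exists s, p < s < q /\ P s.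
Proof.
move=> pq [e he]; have e0 := cond_pos e.
exists (p + Rmin (e / 2) ((q - p) / 2)).
have m1 := Rmin_l (e / 2) ((q - p) / 2); have m2 := Rmin_r (e / 2) ((q - p) / 2).
have m0 : 0 < Rmin (e / 2) ((q - p) / 2) by apply: Rmin_pos; lra.
split; first lra.
apply: he; change (Rabs (p + Rmin (e / 2) ((q - p) / 2) - p) < e).
by rewrite Rabs_right; lra.
Qed.

(* [tan s / s] is the reciprocal of [zc s]; unlike [zc] it is continuous at [PI]. *)
Definition wc (s : R) : R := tan s / s.

Lemma wc_PI : wc PI = 0.
Proof. by rewrite /wc tan_PI; field; have := PI_gt_3; lra. Qed.

Lemma continuous_wc : continuous wc PI.
Proof.
have p3 := PI_gt_3.
apply: continuous_of_derive; rewrite /wc /tan; auto_derive.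
by rewrite cos_PI; lra.
Qed.

Lemma zc_wc (s : R) : PI < s -> s < 3 / 2 * PI -> 0 < wc s /\ zc s = / wc s.
Proof.
move=> h1 h2; have p3 := PI_gt_3; have ss := sin_neg_arc s h1 h2.
have cs : cos s < 0 by apply: cos_lt_0; lra.
split; last by rewrite /zc /wc /cot /tan; field; lra.
rewrite /wc /tan; apply: Rdiv_lt_0_compat; last lra.
have -> : sin s / cos s = (- sin s) / (- cos s) by field; lra.
by apply: Rdiv_lt_0_compat; lra.
Qed.

(** [1 / ca] and [cb^2 / ca] with [zc = 1 / wc] substituted and the inner fractions cleared. These
    forms are continuous at [PI], with values [0] and [4 / PI]. *)
Definition inv_ca (s : R) : R := s * wc s ^ 2 / (1 + wc s + (s ^ 2 - 2) * wc s ^ 2).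
Definition cb2_ca (s : R) : R := 4 * (1 - wc s) ^ 2 / (s * (1 + wc s + (s ^ 2 - 2) * wc s ^ 2)).

Lemma inv_ca_E (s : R) : PI < s -> s < 3 / 2 * PI ->
  / ca s = inv_ca s /\ cb s ^ 2 / ca s = cb2_ca s.
Proof.
move=> h1 h2; have p3 := PI_gt_3; have [w0 zE] := zc_wc s h1 h2.
have N0 : 0 < 1 + wc s + (s ^ 2 - 2) * wc s ^ 2.
  have : 0 < (s ^ 2 - 2) * wc s ^ 2 by apply: Rmult_lt_0_compat; nra.
  lra.
have aE : ca s = (1 + wc s + (s ^ 2 - 2) * wc s ^ 2) / (s * wc s ^ 2).
  by rewrite /ca zE; field; lra.
have bE : cb s = 2 * (1 - wc s) / (s * wc s) by rewrite /cb zE; field; lra.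
rewrite aE bE /inv_ca /cb2_ca; move: (1 + wc s + _) N0 => N N0.
split; field; repeat split; lra.
Qed.

Lemma continuous_inv_ca : continuous inv_ca PI /\ continuous cb2_ca PI.
Proof.
have p3 := PI_gt_3; have cw := continuous_wc.
have cid : continuous (fun s : R => s) PI by apply: continuous_id.
have N0 : continuous (fun s => 1 + wc s + (s ^ 2 - 2) * wc s ^ 2) PI.
  apply: (continuous_plus (fun s => 1 + wc s)).
    by apply: (continuous_plus (fun=> 1)) => //; apply: continuous_const.
  apply: (continuous_mult (fun s => s ^ 2 - 2)); last exact: continuous_pow.
  by apply: continuous_of_derive; auto_derive.
split; apply: continuous_div.
- by apply: (continuous_mult (fun s => s)) => //; apply: continuous_pow.
- exact: N0.
- by rewrite wc_PI; lra.
- apply: (continuous_mult (fun=> 4)); first exact: continuous_const.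
  by apply: continuous_pow; apply: (continuous_minus (fun=> 1)) => //; apply: continuous_const.
- exact: (continuous_mult (fun s => s)).
- by rewrite wc_PI; lra.
Qed.

(** From [a k sqrt (1 - k) = c] and [1/2 <= sqrt (1 - k) <= 1] one gets [c <= a k <= 2 c]. The first
    bound serves the term [sqrt k b], the second the subtracted [sqrt k (a k)]. The resulting
    estimate tends to [2 sqrt c / sqrt PI] at [PI]. *)
Lemma height_lower_bound (s c : R) : PI < s -> s < 3 / 2 * PI -> 1 <= zc s -> 0 < c ->
  c ^ 2 / ca s ^ 2 < 1 / 8 ->
  sqrt (c * cb2_ca s) - 2 * c * sqrt (2 * c * inv_ca s) <= height s c.
Proof.
move=> h1 h2 hz c0 h3.
have [<- <-] := inv_ca_E s h1 h2.
have a0 := ca_gt0 s h1 hz; have b0 := cb_ge0 s h1 hz.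
have [k0 kE] := angle_spec s c c0 a0 h3.
rewrite /height; move: (angle s c) (ca s) (cb s) k0 kE a0 b0 => k a b k0 kE a0 b0.
have y0 : 0 < sqrt (1 - k) by apply: sqrt_lt_R0; lra.
have y2 : sqrt (1 - k) ^ 2 = 1 - k by apply: pow2_sqrt; lra.
set y := sqrt (1 - k) in kE y0 y2.
have y3 : 1 / 2 <= y by nra.
have y4 : y <= 1 by nra.
have ak : a * k <= 2 * c by rewrite -kE; nra.
have ck : c <= a * k by rewrite -kE; nra.
have e1 : sqrt (c * (b ^ 2 / a)) <= sqrt k * b.
  have -> : sqrt k * b = sqrt (k * b ^ 2) by rewrite sqrt_mult ?sqrt_pow2 //; nra.
  apply: sqrt_le_1_alt; apply: (Rmult_le_reg_r a) => //.
  have -> : c * (b ^ 2 / a) * a = c * b ^ 2 by field; lra.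
  nra.
have e2 : sqrt k <= sqrt (2 * c * / a).
  apply: sqrt_le_1_alt; apply: (Rmult_le_reg_r a) => //.
  have -> : 2 * c * / a * a = 2 * c by field; lra.
  lra.
have s0 : 0 <= sqrt k by apply: sqrt_pos.
have : sqrt k * (a * k) <= 2 * c * sqrt (2 * c * / a).
  by rewrite Rmult_comm; apply: Rmult_le_compat; nra.
lra.
Qed.

Lemma cb_large (M : R) : locally PI (fun s => PI < s -> s < 3 / 2 * PI -> M < cb s).
Proof.
have p3 := PI_gt_3; have p4 := PI_4.
(* [zc s > K] gives [cb s > (8 |M| + 2) / s], and [s < 6] on the arc. *)
pose K := Rabs M * 4 + 2.
have K0 : 2 <= K by rewrite /K; have := Rabs_pos M; lra.
have hK : wc PI < / K by rewrite wc_PI; apply: Rinv_0_lt_compat; lra.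
have o : locally PI (fun s => wc s < / K) := continuous_wc _ (open_lt (/ K) _ hK).
apply: filter_imp o => s hs h1 h2.
have [w0 zE] := zc_wc s h1 h2.
have zK : K < zc s by rewrite zE -(Rinv_inv K); apply: Rinv_lt_contravar => //;
  apply: Rmult_lt_0_compat => //; apply: Rinv_0_lt_compat; lra.
rewrite /cb; apply: (Rmult_lt_reg_r s); first lra.
have -> : 2 * (zc s - 1) / s * s = 2 * (zc s - 1) by field; lra.
have := Rle_abs M; have := Rabs_pos M.
rewrite /K in zK; nra.
Qed.

Lemma cb_lt_ca (s : R) : PI < s -> 1 <= zc s -> cb s / ca s < 1 / 2.
Proof.
move=> h1 h2; have a0 := ca_gt0 s h1 h2; have := double_cb_lt_ca s h1 => h.
apply: (Rmult_lt_reg_r (ca s)) => //.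
have -> : cb s / ca s * ca s = cb s by field; lra.
lra.
Qed.

(* At the right end of the radii carrying the value [c] of the first coordinate,
   the height vanishes. *)
Lemma height_zero (th c : R) : first_tan_fixpoint th -> 0 < c ->
  exists r, PI < r < th /\ c ^ 2 / ca r ^ 2 < 1 / 8 /\ height r c = 0.
Proof.
move=> hth c0; have [h1 [h2 _]] := hth.
(* Zero height means [k = b / a], and the first coordinate is then [b sqrt (1 - b / a)]; [g]
   compares its square with [c^2]. It vanishes at [th], where [b = 0], and exceeds [c] once
   [b > 2 c], because [b / a < 1/2]. *)
pose g r := c ^ 2 - cb r ^ 2 * (1 - cb r / ca r).
have [s [s1 s2]] := pick_right_of PI th _ h1 (cb_large (2 * c)).
have {}s2 := s2 ltac:(lra) ltac:(lra).
have arc t : s <= t <= th -> PI < t /\ t < 3 / 2 * PI /\ 1 <= zc t.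
  by move=> ht; split; [lra | split; [lra | apply: (zc_ge1 th) => //; lra]].
have gc t : s <= t <= th -> continuity_pt g t.
  move=> ht; have [t1 [t2 t3]] := arc t ht.
  have t4 := ca_gt0 t t1 t3.
  have ka := continuous_ca t t1 t2; have kb := continuous_cb t t1 t2.
  apply/continuity_pt_filterlim.
  apply: (continuous_minus (fun=> c ^ 2)); first exact: continuous_const.
  apply: (continuous_mult (fun t => cb t ^ 2)); first exact: continuous_pow.
  apply: (continuous_minus (fun=> 1)); first exact: continuous_const.
  by apply: continuous_div => //; lra.
have gs : g s < 0.
  have [t1 [t2 t3]] := arc s ltac:(lra).
  by have := cb_lt_ca s t1 t3; rewrite /g; nra.
have gth : 0 < g th.
  have -> : g th = c ^ 2 by rewrite /g /cb zc_theta // /Rdiv; ring.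
  nra.
have [r [r1 r2]] := Ranalysis5.IVT_interv g s th gc ltac:(lra) gs gth.
have rth : r < th by case: r1 => _ [//|h]; rewrite h in r2; lra.
exists r; have [t1 [t2 _]] := arc r r1.
have t3 := zc_gt1 th r hth t1 rth.
have a0 := ca_gt0 r t1 ltac:(lra); have b0 := cb_gt0 r t1 t3; have bl := cb_lt_ca r t1 ltac:(lra).
rewrite /height; rewrite /g in r2.
have k0 : 0 < cb r / ca r by apply: Rdiv_lt_0_compat.
have [] := angle_unique r c (cb r / ca r) a0 k0 bl.
  have -> : ca r * (cb r / ca r) = cb r by field; lra.
  apply: Rsqr_inj; [by apply: Rmult_le_pos; [lra | exact: sqrt_pos] | lra |].
  by rewrite !Rsqr_pow2 Rpow_mult_distr pow2_sqrt; lra.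
move=> h3 ->; do 2 (split=> //).
by field; lra.
Qed.

(** Intermediate values between the radius of height zero and a radius near [PI]. The detour through
    [low] serves its continuity at [PI], where [height] involves the singular [zc]. *)
Lemma height_surj (th c d : R) : first_tan_fixpoint th -> 0 < c -> 0 < d ->
  d < 2 / sqrt PI * sqrt c ->
  exists r, PI < r < th /\ c ^ 2 / ca r ^ 2 < 1 / 8 /\ height r c = d.
Proof.
move=> hth c0 d0 hd; have [h1 [h2 _]] := hth; have p3 := PI_gt_3.
have [q [hq1 [hq2 hq3]]] := height_zero th c hth c0.
pose low s := sqrt (c * cb2_ca s) - 2 * c * sqrt (2 * c * inv_ca s).
have lowc : continuous low PI.
  have [ci cb2] := continuous_inv_ca.
  apply: (continuous_minus (fun s => sqrt (c * cb2_ca s))).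
    apply: (continuous_comp (fun s => c * cb2_ca s) sqrt); last exact: continuous_sqrt.
    by apply: (continuous_mult (fun=> c)) => //; apply: continuous_const.
  apply: (continuous_mult (fun=> 2 * c)); first exact: continuous_const.
  apply: (continuous_comp (fun s => 2 * c * inv_ca s) sqrt); last exact: continuous_sqrt.
  by apply: (continuous_mult (fun=> 2 * c)) => //; apply: continuous_const.
have lowPI : d < low PI.
  rewrite /low /inv_ca /cb2_ca wc_PI.
  have -> : 2 * c * (PI * 0 ^ 2 / (1 + 0 + (PI ^ 2 - 2) * 0 ^ 2)) = 0 by field; lra.
  have -> : c * (4 * (1 - 0) ^ 2 / (PI * (1 + 0 + (PI ^ 2 - 2) * 0 ^ 2))) = 2 ^ 2 * (c / PI)
    by field; lra.
  rewrite sqrt_0 sqrt_mult; [|lra|by apply: Rlt_le; apply: Rdiv_lt_0_compat; lra].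
  rewrite sqrt_pow2; last lra.
  rewrite sqrt_div; [|lra|lra].
  by move: hd; rewrite /Rdiv; lra.
have [s [s1 s2]] := pick_right_of PI q _ (proj1 hq1) (lowc _ (open_gt d _ lowPI)).
have adm t : s <= t <= q -> c ^ 2 / ca t ^ 2 < 1 / 8.
  move=> [t1 [t2|->]] //; apply: (admissible_left th t q) => //; lra.
have low_s : d < height s c.
  apply: (Rlt_le_trans _ (low s)) => //; apply: height_lower_bound => //; try lra.
    by apply: (zc_ge1 th) => //; lra.
  by apply: adm; lra.
have hc t : s <= t <= q -> continuity_pt (fun t => d - height t c) t.
  move=> ht; apply/continuity_pt_filterlim; change (continuous (fun t => d - height t c) t).
  apply: (continuous_minus (fun=> d)); first exact: continuous_const.
  apply: (continuous_height R_UniformSpace (fun t => t) (fun=> c)) => //; try lra.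
  - exact: continuous_const.
  - by apply: ca_gt0; [lra | apply: (zc_ge1 th) => //; lra].
  - exact: adm.
have [r [r1 r2]] := Ranalysis5.IVT_interv (fun t => d - height t c) s q hc ltac:(lra) ltac:(lra) ltac:(lra).
by exists r; split; [lra | split; [exact: adm | lra]].
Qed.

(** * The radius as a continuous function of the target point *)

Definition radius (th : R) (u : 'I_2 -> R) : R :=
  ClassicalEpsilon.epsilon (inhabits 0) (fun r => PI < r < th /\ u j0 ^ 2 / ca r ^ 2 < 1 / 8 /\ height r (u j0) = u j1).

Lemma radius_spec (th : R) (u : 'I_2 -> R) : first_tan_fixpoint th -> R2_lt_plus u ->
  PI < radius th u < th /\ u j0 ^ 2 / ca (radius th u) ^ 2 < 1 / 8
  /\ height (radius th u) (u j0) = u j1.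
Proof.
move=> hth [h1 [h2 h3]]; rewrite /radius.
apply: (ClassicalEpsilon.epsilon_spec (inhabits 0)
  (fun r => PI < r < th /\ u j0 ^ 2 / ca r ^ 2 < 1 / 8 /\ height r (u j0) = u j1)).
exact: height_surj.
Qed.

Lemma radius_unique (th r : R) (u : 'I_2 -> R) : first_tan_fixpoint th -> R2_lt_plus u ->
  PI < r < th -> u j0 ^ 2 / ca r ^ 2 < 1 / 8 -> height r (u j0) = u j1 -> radius th u = r.
Proof.
move=> hth hu r1 r2 r3; have [s1 [s2 s3]] := radius_spec th u hth hu.
have [u0 _] := hu.
case: (Rtotal_order (radius th u) r) => [h|[//|h]].
  by have := height_decr th (radius th u) r (u j0) hth u0; lra.
by have := height_decr th r (radius th u) (u j0) hth u0; lra.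
Qed.

Lemma continuous_coord (n : nat) (i : 'I_n) (v : fct_UniformSpace 'I_n R_UniformSpace) :
  continuous (fun w : fct_UniformSpace 'I_n R_UniformSpace => w i) v.
Proof. by apply/filterlim_locally => e; exists e => w hw; apply: hw. Qed.

Lemma locally_R2_lt_plus (u : fct_UniformSpace 'I_2 R_UniformSpace) :
  R2_lt_plus u -> locally u R2_lt_plus.
Proof.
move=> [u0 [u1 u2]].
have c0 := continuous_coord 2 j0 u; have c1 := continuous_coord 2 j1 u.
have l0 : locally u (fun w => 0 < w j0) := c0 _ (open_gt 0 _ u0).
have l1 : locally u (fun w => 0 < w j1) := c1 _ (open_gt 0 _ u1).
have c2 : continuous (fun w : fct_UniformSpace 'I_2 R_UniformSpace => 2 / sqrt PI * sqrt (w j0) - w j1) u.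
  apply: (continuous_minus (fun w : fct_UniformSpace 'I_2 R_UniformSpace => 2 / sqrt PI * sqrt (w j0))) => //.
  apply: (continuous_mult (fun=> 2 / sqrt PI)); first exact: continuous_const.
  exact: (continuous_comp _ sqrt _ c0 (continuous_sqrt _)).
have l2 : locally u (fun w => 0 < 2 / sqrt PI * sqrt (w j0) - w j1).
  by apply: (c2 _ (open_gt 0 _ _)); lra.
apply: filter_imp (filter_and _ _ l0 (filter_and _ _ l1 l2)) => w [w0 [w1 w2]].
by split=> //; split=> //; lra.
Qed.

(** The height is controlled only at admissible radii, so an admissible [q] beyond the radius at [u]
    is fixed first. By continuity it stays admissible for nearby targets, and with it every radius
    in [(PI, q]]. *)
Lemma continuous_radius (th : R) (u : fct_UniformSpace 'I_2 R_UniformSpace) :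
  first_tan_fixpoint th -> R2_lt_plus u -> continuous (radius th : fct_UniformSpace 'I_2 R_UniformSpace -> R) u.
Proof.
move=> hth hu; have [r1 [r2 r3]] := radius_spec th u hth hu.
have [u0 _] := hu; have p3 := PI_gt_3; have [_ [hth2 _]] := hth.
set T := fct_UniformSpace 'I_2 R_UniformSpace.
set r := radius th u in r1 r2 r3.
have ac t : PI < t < th -> 0 < ca t.
  by move=> ht; apply: ca_gt0; [lra | apply: (zc_ge1 th) => //; lra].
have [q [hq1 hq2]] : exists q, r < q < th /\ u j0 ^ 2 / ca q ^ 2 < 1 / 8.
  have hc : continuous (fun t => u j0 ^ 2 / ca t ^ 2) r.
    apply: continuous_div; [exact: continuous_const | apply: continuous_pow; apply: continuous_ca; lra |].
    by have := ac r r1; nra.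
  by have [q hq] := pick_right_of r th _ (proj2 r1) (hc _ (open_lt (1 / 8) _ r2)); exists q.
have c0 := continuous_coord 2 j0 u.
have adm : locally u (fun w : T => R2_lt_plus w /\ w j0 ^ 2 / ca q ^ 2 < 1 / 8).
  apply: filter_and; first exact: locally_R2_lt_plus.
  have hc : continuous (fun w : T => w j0 ^ 2 / ca q ^ 2) u.
    apply: continuous_div; [exact: continuous_pow | exact: continuous_const |].
    by have := ac q ltac:(lra); nra.
  exact: (hc _ (open_lt (1 / 8) _ hq2)).
pose e := Rmin ((r - PI) / 2) (q - r).
have e1 : 0 < e by apply: Rmin_pos; lra.
have near x : Rabs (x - r) <= e -> PI < x <= q.
  have := Rmin_l ((r - PI) / 2) (q - r); have := Rmin_r ((r - PI) / 2) (q - r).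
  by rewrite -/e => ? ? /Rabs_le_between; lra.
have admx w x : 0 < w j0 -> PI < x <= q -> w j0 ^ 2 / ca q ^ 2 < 1 / 8 -> w j0 ^ 2 / ca x ^ 2 < 1 / 8.
  by move=> w0 [x1 [x2|->]] // ; apply: (admissible_left th) => //; lra.
apply: (continuous_of_sign_change T (fun w x => height x (w j0) - w j1) (radius th) u e) => //.
- move=> x hx; have x1 := near x hx.
  apply: (continuous_minus (fun w : T => height x (w j0))); last exact: continuous_coord.
  apply: (continuous_height T (fun=> x) (fun w => w j0)) => //; try lra.
  + exact: continuous_const.
  + by apply: ac; lra.
  + exact: admx.
apply: filter_imp adm => w [hw hw2] x hx; have x1 := near x hx.
have [w0 _] := hw.
have [s1 [s2 s3]] := radius_spec th w hth hw.
have x2 := admx w x w0 x1 hw2.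
case: (Rtotal_order x (radius th w)) => [h|[h|h]].
- by have := height_decr th x (radius th w) (w j0) hth w0; lra.
- by rewrite h; lra.
- by have := height_decr th (radius th w) x (w j0) hth w0; lra.
Qed.

(** * [Lambda] in the coordinates [(r, k)] and its bijectivity *)

Lemma ord2P (P : 'I_2 -> Prop) : P j0 -> P j1 -> forall i, P i.
Proof.
move=> h0 h1 [[|[|//]] p].
  by rewrite (_ : Ordinal p = j0) //; apply: val_inj.
by rewrite (_ : Ordinal p = j1) //; apply: val_inj.
Qed.

Lemma psi_zc (r : R) : r <> 0 -> psi r = (1 - zc r) / r ^ 2.
Proof. by rewrite /psi; case: Req_EM_T. Qed.

Lemma psi_cb (r : R) : r <> 0 -> psi r = - cb r / (2 * r).
Proof. by move=> r0; rewrite psi_zc // /cb; field. Qed.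

Lemma dpsi_ca (r : R) : PI < r -> r < 3 / 2 * PI -> dpsi r = ca r / r ^ 2.
Proof.
move=> h1 h2; have p3 := PI_gt_3; have dz := is_derive_zc r ltac:(lra) (sin_neq0_arc r h1 h2).
apply: is_derive_unique; apply: (is_derive_ext_loc (fun s => (1 - zc s) / s ^ 2)).
  have o : locally r (fun s => 0 < s) by apply: (open_gt 0); lra.
  by apply: filter_imp o => s hs; rewrite psi_zc //; lra.
have hD : Derive (fun x => zc x) r = (zc r - r ^ 2 - zc r ^ 2) / r by exact: is_derive_unique.
auto_derive; last by rewrite hD /ca; field; lra.
by split; [eexists; exact: dz | split => //; nra].
Qed.

Lemma norm2_sqr (v : 'I_2 -> R) : norm2 v ^ 2 = v j0 ^ 2 + v j1 ^ 2.
Proof. by apply: pow2_sqrt; nra. Qed.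

Lemma norm2_gt0 (v : 'I_2 -> R) : 0 < v j0 -> 0 < norm2 v.
Proof. by move=> v0; apply: sqrt_lt_R0; nra. Qed.

(** The signs of the two coordinates select the square roots, so [r] and [k] determine [v] in this
    quadrant. *)
Lemma polar_k (v : 'I_2 -> R) : 0 < v j0 -> v j1 < 0 ->
  let r := norm2 v in let k := v j1 ^ 2 / r ^ 2 in
  0 < k < 1 /\ v j0 = r * sqrt (1 - k) /\ v j1 = - (r * sqrt k).
Proof.
move=> v0 v1 r k; have r0 : 0 < r := norm2_gt0 v v0.
have r2 : r ^ 2 = v j0 ^ 2 + v j1 ^ 2 := norm2_sqr v.
have k0 : 0 < k by apply: Rdiv_lt_0_compat; nra.
have kE : 1 - k = (v j0 / r) ^ 2.
  transitivity ((r ^ 2 - v j1 ^ 2) / r ^ 2); first by rewrite /k; field; lra.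
  by rewrite r2 /Rdiv Rpow_mult_distr pow_inv r2; congr (_ * _); ring.
have k1 : k < 1.
  have : 0 < (v j0 / r) ^ 2 by apply: pow_lt; apply: Rdiv_lt_0_compat.
  lra.
split; first by split.
rewrite kE sqrt_pow2; last by left; apply: Rdiv_lt_0_compat.
split; first by field; lra.
have -> : k = (- v j1 / r) ^ 2 by rewrite /k; field; lra.
rewrite sqrt_pow2; last by left; apply: Rdiv_lt_0_compat; lra.
by field; lra.
Qed.

Lemma Lambda_polar (v : 'I_2 -> R) : 0 < v j0 -> v j1 < 0 ->
  let r := norm2 v in let k := v j1 ^ 2 / r ^ 2 in PI < r -> r < 3 / 2 * PI ->
  Lambda v j0 = ca r * k * sqrt (1 - k) /\ Lambda v j1 = sqrt k * (cb r - ca r * k).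
Proof.
move=> v0 v1 r k h1 h2; have r0 : 0 < r := norm2_gt0 v v0.
have [[k0 k1] [e0 e1]] := polar_k v v0 v1.
rewrite -/r -/k in k0 k1 e0 e1.
rewrite /Lambda /vec2 /= -/r dpsi_ca // psi_cb; last lra.
have kE : sqrt k ^ 2 = k by apply: pow2_sqrt; lra.
rewrite e0 e1; move: (sqrt k) kE (ca r) (cb r) => s <- a b.
by split; field; lra.
Qed.

Lemma K3_polar (v : 'I_2 -> R) : 0 < v j0 ->
  let r := norm2 v in let k := v j1 ^ 2 / r ^ 2 in PI < r -> r < 3 / 2 * PI ->
  K3 v = (ca r * k - cb r) / r.
Proof.
move=> v0 r k h1 h2; have r0 : 0 < r := norm2_gt0 v v0.
rewrite /K3 -/r dpsi_ca // psi_cb; last lra.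
by rewrite /k; field; lra.
Qed.

Lemma norm2_polar (r k : R) (v : 'I_2 -> R) : 0 < r -> 0 <= k <= 1 ->
  v j0 = r * sqrt (1 - k) -> v j1 = - (r * sqrt k) -> norm2 v = r.
Proof.
move=> r0 hk e0 e1; rewrite /norm2.
rewrite (_ : v j0 ^ 2 + v j1 ^ 2 = r ^ 2); first by apply: sqrt_pow2; lra.
rewrite e0 e1; transitivity (r ^ 2 * (sqrt (1 - k) ^ 2 + sqrt k ^ 2)); first by ring.
by rewrite !pow2_sqrt; [ring | lra | lra].
Qed.

Lemma Omega_polar (th : R) (v : 'I_2 -> R) : first_tan_fixpoint th -> Omega_m4 th v ->
  let r := norm2 v in let k := v j1 ^ 2 / r ^ 2 in
  PI < r < th /\ 0 < k < cb r / ca r /\ 0 < v j0 /\ v j1 < 0.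
Proof.
move=> hth [v1 [v0 [vr [rth hK]]]] r k; have p3 := PI_gt_3; have [_ [hth2 _]] := hth.
have v00 : 0 < v j0 by lra.
have r0 : PI < r by rewrite /r; lra.
have [[k0 _] _] := polar_k v v00 v1.
rewrite (K3_polar v v00 ltac:(lra) ltac:(lra)) -/r -/k in hK.
have a0 : 0 < ca r by apply: ca_gt0 => //; apply: (zc_ge1 th) => //; rewrite /r; lra.
split=> //; split=> //; split; first exact: k0.
apply: (Rmult_lt_reg_r (ca r)) => //.
have -> : cb r / ca r * ca r = cb r by field; lra.
have e : ca r * k - cb r = (ca r * k - cb r) / r * r by field; lra.
have : ca r * k - cb r < 0 by rewrite e; nra.
lra.
Qed.

Lemma Omega_of_polar (th r k : R) (v : 'I_2 -> R) : first_tan_fixpoint th ->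
  PI < r < th -> 0 < k < cb r / ca r -> v j0 = r * sqrt (1 - k) -> v j1 = - (r * sqrt k) ->
  Omega_m4 th v /\ norm2 v = r /\ v j1 ^ 2 / r ^ 2 = k.
Proof.
move=> hth hr hk e0 e1; have p3 := PI_gt_3; have [_ [hth2 _]] := hth.
have z1 := zc_gt1 th r hth ltac:(lra) ltac:(lra).
have a0 := ca_gt0 r ltac:(lra) ltac:(lra).
have k1 := cb_lt_ca r ltac:(lra) ltac:(lra).
have nv : norm2 v = r by apply: (norm2_polar r k) => //; lra.
have s0 : 0 < sqrt k by apply: sqrt_lt_R0; lra.
have kE : v j1 ^ 2 / r ^ 2 = k.
  rewrite e1; have -> : (- (r * sqrt k)) ^ 2 = r ^ 2 * sqrt k ^ 2 by ring.
  by rewrite pow2_sqrt; [field; lra | lra].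
have akb : ca r * k < cb r.
  have -> : cb r = ca r * (cb r / ca r) by field; lra.
  by apply: Rmult_lt_compat_l; lra.
have hrad := cb_ca_radius r ltac:(lra) ltac:(lra) ltac:(lra).
(* [hrad] is the estimate at the edge [k = b / a]; [a k < b] carries it inside, giving
   [PI^2 < r^2 (1 - k)]. *)
have v0 : PI < v j0.
  rewrite e0; apply: Rsqr_incrst_0; [|lra|by apply: Rmult_le_pos; [lra|exact: sqrt_pos]].
  rewrite !Rsqr_pow2 Rpow_mult_distr pow2_sqrt; last lra.
  apply: (Rmult_lt_reg_l (ca r)) => //; nra.
have v1 : v j1 < 0 by rewrite e1; nra.
split; last by split.
split=> //; split=> //; split.
  rewrite nv e0 -{2}(Rmult_1_r r); apply: Rmult_lt_compat_l; first lra.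
  by rewrite -{2}sqrt_1; apply: sqrt_lt_1_alt; lra.
split; first lra.
rewrite K3_polar ?nv ?kE //; try lra.
have -> : (ca r * k - cb r) / r = - ((cb r - ca r * k) / r) by field; lra.
have : 0 < (cb r - ca r * k) / r by apply: Rdiv_lt_0_compat; lra.
lra.
Qed.

(** The source of the bound [u_2 < 2 / sqrt PI * sqrt u_1]. It combines [PI < r] with
    [(z - 1)^2 < r^2 + z^2 + z - 2]. *)
Lemma cb2_ca_lt (r : R) : PI < r -> 1 <= zc r -> cb r ^ 2 / ca r < 4 / PI.
Proof.
move=> h1 h2; have p3 := PI_gt_3; have a0 := ca_gt0 r h1 h2.
apply: (Rmult_lt_reg_r (ca r * PI)); first nra.
have -> : cb r ^ 2 / ca r * (ca r * PI) = cb r ^ 2 * PI by field; lra.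
have -> : 4 / PI * (ca r * PI) = 4 * ca r by field; lra.
rewrite /cb /ca; apply: (Rmult_lt_reg_r (r ^ 2)); first nra.
have -> : (2 * (zc r - 1) / r) ^ 2 * PI * r ^ 2 = 4 * (PI * (zc r - 1) ^ 2) by field; lra.
have -> : 4 * ((r ^ 2 + zc r ^ 2 + zc r - 2) / r) * r ^ 2 = 4 * (r * (r ^ 2 + zc r ^ 2 + zc r - 2)) by field; lra.
have h : (zc r - 1) ^ 2 < r ^ 2 + zc r ^ 2 + zc r - 2 by nra.
have : 0 <= (zc r - 1) ^ 2 by nra.
nra.
Qed.

Lemma Lambda_range (th : R) (v : 'I_2 -> R) : first_tan_fixpoint th -> Omega_m4 th v ->
  R2_lt_plus (Lambda v).
Proof.
move=> hth hv; have p3 := PI_gt_3; have [_ [hth2 _]] := hth.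
have [hr [hk [v0 v1]]] := Omega_polar th v hth hv.
have [_ [e0 e1]] := polar_k v v0 v1.
have [l0 l1] := Lambda_polar v v0 v1 ltac:(lra) ltac:(lra).
rewrite /R2_lt_plus l0 l1.
set r := norm2 v in hr hk *; set k := v j1 ^ 2 / r ^ 2 in hk *.
have z1 := zc_gt1 th r hth ltac:(lra) ltac:(lra).
have a0 := ca_gt0 r ltac:(lra) ltac:(lra); have b0 := cb_gt0 r ltac:(lra) ltac:(lra).
have k1 := cb_lt_ca r ltac:(lra) ltac:(lra).
have ab := double_cb_lt_ca r ltac:(lra).
have lim := cb2_ca_lt r ltac:(lra) ltac:(lra).
have akb : ca r * k < cb r.
  have -> : cb r = ca r * (cb r / ca r) by field; lra.
  by apply: Rmult_lt_compat_l; lra.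
move: (ca r) (cb r) a0 b0 ab lim akb => a b a0 b0 ab lim akb.
clearbody k; clear l0 l1.
have sk0 : 0 < sqrt k by apply: sqrt_lt_R0; lra.
have sy0 : 0 < sqrt (1 - k) by apply: sqrt_lt_R0; lra.
have c0 : 0 < a * k * sqrt (1 - k) by apply: Rmult_lt_0_compat => //; nra.
split=> //; split; first by apply: Rmult_lt_0_compat; lra.
have y2 : sqrt (1 - k) ^ 2 = 1 - k by apply: pow2_sqrt; lra.
set y := sqrt (1 - k) in sy0 c0 y2 *.
have spi : 0 < sqrt PI by apply: sqrt_lt_R0; lra.
apply: Rsqr_incrst_0; last 2 first.
- by apply: Rmult_le_pos; lra.
- by apply: Rmult_le_pos; [left; apply: Rdiv_lt_0_compat; lra | exact: sqrt_pos].
rewrite !Rsqr_pow2 !Rpow_mult_distr !pow2_sqrt; [|lra|lra].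
have -> : 2 ^ 2 * (/ sqrt PI) ^ 2 = 4 / PI by rewrite pow_inv pow2_sqrt; [field; lra | lra].
have yk : 1 - k < y by nra.
have hb : b ^ 2 < 4 / PI * a.
  have -> : b ^ 2 = b ^ 2 / a * a by field; lra.
  exact: Rmult_lt_compat_r.
(* [2 b < a] gives [b - a k <= b (1 - 2 k)], and [(1 - 2 k)^2 < 1 - k < y] for [0 < k < 1/2]. *)
have h1 : (b - a * k) ^ 2 < b ^ 2 * y.
  have h : b - a * k <= b * (1 - 2 * k) by nra.
  have h' : (b - a * k) ^ 2 <= (b * (1 - 2 * k)) ^ 2 by apply: pow_incr; lra.
  have h2 : (1 - 2 * k) ^ 2 < y by nra.
  have : 0 < b ^ 2 by nra.
  rewrite Rpow_mult_distr in h'; nra.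
have : k * (b - a * k) ^ 2 < k * (b ^ 2 * y) by apply: Rmult_lt_compat_l; lra.
have : b ^ 2 * (k * y) < 4 / PI * a * (k * y) by apply: Rmult_lt_compat_r => //; nra.
lra.
Qed.

Definition LambdaInv (th : R) (u : 'I_2 -> R) : 'I_2 -> R :=
  let r := radius th u in let k := angle r (u j0) in
  vec2 (r * sqrt (1 - k)) (- (r * sqrt k)).

Lemma LambdaInv_spec (th : R) (u : 'I_2 -> R) : first_tan_fixpoint th -> R2_lt_plus u ->
  Omega_m4 th (LambdaInv th u) /\ forall i, Lambda (LambdaInv th u) i = u i.
Proof.
move=> hth hu; have p3 := PI_gt_3; have [_ [hth2 _]] := hth.
have [hr [h1 h2]] := radius_spec th u hth hu.
have [u0 [u1 _]] := hu.
set v := LambdaInv th u; set r := radius th u in hr h1 h2.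
have z1 := zc_gt1 th r hth ltac:(lra) ltac:(lra).
have a0 := ca_gt0 r ltac:(lra) ltac:(lra).
have [k0 kE] := angle_spec r (u j0) u0 a0 h1.
set k := angle r (u j0) in k0 kE.
(* Positivity of [u_2], which is the height, puts [k] below [b / a] and so gives [K3 < 0]. *)
have hk : 0 < k < cb r / ca r.
  split; first lra.
  rewrite /height -/k in h2.
  have s0 : 0 < sqrt k by apply: sqrt_lt_R0; lra.
  have : 0 < cb r - ca r * k by nra.
  move=> h; apply: (Rmult_lt_reg_r (ca r)) => //.
  have -> : cb r / ca r * ca r = cb r by field; lra.
  lra.
have e0 : v j0 = r * sqrt (1 - k) by [].
have e1 : v j1 = - (r * sqrt k) by [].
have [hO [nv kv]] := Omega_of_polar th r k v hth hr hk e0 e1.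
split=> //; have [_ [_ [v0 v1]]] := Omega_polar th v hth hO.
have [l0 l1] := Lambda_polar v v0 v1 ltac:(lra) ltac:(lra).
by apply: ord2P; rewrite ?l0 ?l1 nv kv // -h2.
Qed.

Lemma LambdaK (th : R) (v : 'I_2 -> R) : first_tan_fixpoint th -> Omega_m4 th v ->
  forall i, LambdaInv th (Lambda v) i = v i.
Proof.
move=> hth hv; have p3 := PI_gt_3; have [_ [hth2 _]] := hth.
have hu := Lambda_range th v hth hv.
have [hr [hk [v0 v1]]] := Omega_polar th v hth hv.
have [_ [e0 e1]] := polar_k v v0 v1.
have [l0 l1] := Lambda_polar v v0 v1 ltac:(lra) ltac:(lra).
set r := norm2 v in hr hk e0 e1 l0 l1; set k := v j1 ^ 2 / r ^ 2 in hk e0 e1 l0 l1.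
have z1 := zc_gt1 th r hth ltac:(lra) ltac:(lra).
have a0 := ca_gt0 r ltac:(lra) ltac:(lra).
have k1 := cb_lt_ca r ltac:(lra) ltac:(lra).
have [h1 h2] := angle_unique r (Lambda v j0) k a0 ltac:(lra) ltac:(lra) (esym l0).
have rE : radius th (Lambda v) = r.
  by apply: radius_unique => //; rewrite /height h2 l1.
by apply: ord2P; rewrite /LambdaInv rE h2 /vec2 /= ?e0 ?e1.
Qed.

Lemma continuous_LambdaInv (th : R) (u : fct_UniformSpace 'I_2 R_UniformSpace) (i : 'I_2) :
  first_tan_fixpoint th -> R2_lt_plus u ->
  continuous ((fun u => LambdaInv th u i) : fct_UniformSpace 'I_2 R_UniformSpace -> R) u.
Proof.
move=> hth hu; have p3 := PI_gt_3; have [_ [hth2 _]] := hth.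
have [hr [h1 h2]] := radius_spec th u hth hu.
have [u0 _] := hu.
have cr := continuous_radius th u hth hu.
have ck : continuous ((fun u => angle (radius th u) (u j0)) : fct_UniformSpace 'I_2 R_UniformSpace -> R) u.
  apply: (continuous_angle (fct_UniformSpace 'I_2 R_UniformSpace)) => //; try lra.
    exact: continuous_coord.
  by apply: ca_gt0; [lra | apply: (zc_ge1 th) => //; lra].
move: i; apply: ord2P.
  apply: (continuous_mult (radius th : fct_UniformSpace 'I_2 R_UniformSpace -> R)) => //.
  apply: (continuous_comp _ sqrt); last exact: continuous_sqrt.
  by apply: (continuous_minus (fun=> 1)) => //; apply: continuous_const.
apply: (continuous_opp (fun u : fct_UniformSpace 'I_2 R_UniformSpace =>
  radius th u * sqrt (angle (radius th u) (u j0)))).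
apply: (continuous_mult (radius th : fct_UniformSpace 'I_2 R_UniformSpace -> R)) => //.
by apply: (continuous_comp _ sqrt) => //; apply: continuous_sqrt.
Qed.

(** * Rational expressions in the coordinates and [z], and their derivatives along maps *)

(* Expressions in the coordinates of a point [p] of R^3 and in [z = zc |p|]; they are closed
   under partial derivatives because [s z' = z - s^2 - z^2]. *)
Inductive expr : Type :=
| ECst of R
| EVar of 'I_3
| EZ
| EAdd of expr & expr
| EMul of expr & expr
| EInv of expr.

Definition ESq : expr :=
  EAdd (EAdd (EMul (EVar i0) (EVar i0)) (EMul (EVar i1) (EVar i1))) (EMul (EVar i2) (EVar i2)).

Fixpoint ev (e : expr) (p : 'I_3 -> R) : R :=
  match e with
  | ECst c => c
  | EVar i => p i
  | EZ => zc (norm3 p)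
  | EAdd e f => ev e p + ev f p
  | EMul e f => ev e p * ev f p
  | EInv e => / ev e p
  end.

Definition kron {n : nat} (i j : 'I_n) : R := if i == j then 1 else 0.

(** For [EZ] the derivative is [(z - S - z^2) p_i / S] with [S = |p|^2]: the norm itself cancels, so
    only its square has to be an expression. *)
Fixpoint dif (i : 'I_3) (e : expr) : expr :=
  match e with
  | ECst _ => ECst 0
  | EVar j => ECst (kron i j)
  | EZ => EMul (EAdd EZ (EMul (ECst (- (1))) (EAdd ESq (EMul EZ EZ)))) (EMul (EVar i) (EInv ESq))
  | EAdd e f => EAdd (dif i e) (dif i f)
  | EMul e f => EAdd (EMul (dif i e) f) (EMul e (dif i f))
  | EInv e => EMul (ECst (- (1))) (EMul (dif i e) (EMul (EInv e) (EInv e)))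
  end.

Fixpoint wf (e : expr) (p : 'I_3 -> R) : Prop :=
  match e with
  | ECst _ => True
  | EVar _ => True
  | EZ => 0 < dot3 p p /\ sin (norm3 p) <> 0
  | EAdd e f => wf e p /\ wf f p
  | EMul e f => wf e p /\ wf f p
  | EInv e => wf e p /\ ev e p <> 0
  end.

Lemma wf_dif (i : 'I_3) (e : expr) (p : 'I_3 -> R) : wf e p -> wf (dif i e) p.
Proof.
elim: e => //= [|e he f hf|e he f hf|e he]; last by tauto.
- by move=> [h1 h2]; rewrite /dot3 in h1; repeat split=> //; rewrite /dot3; lra.
- by tauto.
- by tauto.
Qed.

Lemma ord3P (P : 'I_3 -> Prop) : P i0 -> P i1 -> P i2 -> forall i, P i.
Proof.
move=> h0 h1 h2 [[|[|[|//]]] p].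
- by rewrite (_ : Ordinal p = i0) //; apply: val_inj.
- by rewrite (_ : Ordinal p = i1) //; apply: val_inj.
- by rewrite (_ : Ordinal p = i2) //; apply: val_inj.
Qed.

Definition sum3 (P Q : 'I_3 -> R) : R := P i0 * Q i0 + P i1 * Q i1 + P i2 * Q i2.

Lemma caratheodory (h : R -> R) (x l : R) : is_derive h x l ->
  exists q : R -> R, continuous q x /\ q x = l /\ forall y, h y - h x = q y * (y - x).
Proof.
move=> /is_derive_Reals hd.
exists (fun y => if Req_EM_T y x then l else (h y - h x) / (y - x)); split; last first.
  split; first by case: Req_EM_T.
  by move=> y; case: Req_EM_T => [e|ne] /=; [rewrite e; ring | field; lra].
apply/filterlim_locally => eps.
have [delta hdel] := hd eps (cond_pos eps).
exists delta => y hy.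
change (Rabs (y - x) < delta) in hy.
case: (Req_EM_T x x) => [?|//]; case: (Req_EM_T y x) => [?|ne] /=.
  exact: ball_center.
have := hdel (y - x) ltac:(lra) hy.
by rewrite (_ : x + (y - x) = y); last ring.
Qed.

Lemma is_derive_caratheodory (h q : R -> R) (x : R) : continuous q x ->
  locally x (fun y => h y - h x = q y * (y - x)) -> is_derive h x (q x).
Proof.
move=> hq hl; apply/is_derive_Reals => eps eps0.
have /filterlim_locally /(_ (mkposreal eps eps0)) hq2 := hq.
have [delta hdel] := filter_and _ _ hl hq2.
exists delta => y y0 hy.
have [h1 h2] : h (x + y) - h x = q (x + y) * (x + y - x) /\ ball (q x) eps (q (x + y)).
  by apply: hdel; change (Rabs (x + y - x) < delta); rewrite (_ : x + y - x = y); last ring.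
rewrite h1 (_ : q (x + y) * (x + y - x) / y = q (x + y)); last by field.
exact: h2.
Qed.

(* Differentiability of [f] along [c], in Caratheodory's form. *)
Definition slopes (T : UniformSpace) (c : T -> 'I_3 -> R) (t0 : T) (f : T -> R) (d : 'I_3 -> R) :=
  exists P : 'I_3 -> T -> R, (forall i, continuous (P i) t0 /\ P i t0 = d i) /\
    locally t0 (fun t => f t - f t0 = sum3 (fun i => P i t) (fun i => c t i - c t0 i)).

Lemma slopes_continuous (T : UniformSpace) (c : T -> 'I_3 -> R) (t0 : T) (f : T -> R) (d : 'I_3 -> R) :
  (forall i, continuous (fun t => c t i) t0) -> slopes T c t0 f d -> continuous f t0.
Proof.
move=> hc [P [hP hl]].
have k : continuous (fun t => f t0 + sum3 (fun i => P i t) (fun i => c t i - c t0 i)) t0.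
  have m i : continuous (fun t => P i t * (c t i - c t0 i)) t0.
    apply: (continuous_mult (P i)); first exact: (proj1 (hP i)).
    by apply: (continuous_minus (fun t => c t i)) => //; apply: continuous_const.
  apply: (continuous_plus (fun=> f t0)); first exact: continuous_const.
  apply: (continuous_plus (fun t => P i0 t * (c t i0 - c t0 i0) + P i1 t * (c t i1 - c t0 i1))) => //.
  exact: (continuous_plus (fun t => P i0 t * (c t i0 - c t0 i0))).
apply: (continuous_ext_loc _ _ _ _ k).
by apply: filter_imp hl => t h; rewrite -h; change (f t0 + (f t - f t0) = f t); ring.
Qed.

Lemma continuous_norm_sqr (T : UniformSpace) (c : T -> 'I_3 -> R) (t0 : T) :
  (forall i, continuous (fun t => c t i) t0) -> continuous (fun t => dot3 (c t) (c t)) t0.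
Proof.
move=> hc.
apply: (continuous_plus (fun t => c t i0 * c t i0 + c t i1 * c t i1)); last exact: (continuous_mult (fun t => c t i2)).
by apply: (continuous_plus (fun t => c t i0 * c t i0));
  [exact: (continuous_mult (fun t => c t i0)) | exact: (continuous_mult (fun t => c t i1))].
Qed.

(** With [c] defined on an arbitrary space, one identity yields both continuity in several variables
    and derivatives along curves. In this form the product and inverse rules are algebraic
    identities with continuous coefficients. *)
Lemma slopes_ev (T : UniformSpace) (c : T -> 'I_3 -> R) (t0 : T) (e : expr) :
  (forall i, continuous (fun t => c t i) t0) -> wf e (c t0) ->
  slopes T c t0 (fun t => ev e (c t)) (fun i => ev (dif i e) (c t0)).
Proof.
move=> hc; elim: e => [a|j||e he f hf|e he f hf|e he] /= hw.
- exists (fun _ _ => 0); split; first by move=> i; split=> //; apply: continuous_const.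
  by apply: filter_forall => t; rewrite /sum3; ring.
- exists (fun i _ => kron i j); split; first by move=> i; split=> //; apply: continuous_const.
  by apply: filter_forall => t; move: j hw; rewrite /sum3 /kron; apply: ord3P => _ /=; ring.
- have [S0 ss] := hw.
  have r0 : 0 < norm3 (c t0) by apply: sqrt_lt_R0.
  have rE : norm3 (c t0) ^ 2 = dot3 (c t0) (c t0) by apply: pow2_sqrt; lra.
  have dz := is_derive_zc (norm3 (c t0)) ltac:(lra) ss.
  (* [z] is treated as a function of [S = |p|^2], because the increment of [S] is exactly the sum of
     [(c_i + c0_i) (c_i - c0_i)]. *)
  have dh : is_derive (fun S => zc (sqrt S)) (dot3 (c t0) (c t0))
     ((zc (norm3 (c t0)) - dot3 (c t0) (c t0) - zc (norm3 (c t0)) ^ 2) / (2 * dot3 (c t0) (c t0))).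
    have hD : Derive (fun x => zc x) (norm3 (c t0)) = (zc (norm3 (c t0)) - norm3 (c t0) ^ 2 - zc (norm3 (c t0)) ^ 2) / norm3 (c t0)
      by exact: is_derive_unique.
    auto_derive; first by split; [eexists; exact: dz | split].
    by rewrite -/(norm3 (c t0)) hD -rE; field; lra.
  have [q [q1 [q2 q3]]] := caratheodory _ _ _ dh.
  have cs := continuous_norm_sqr T c t0 hc.
  exists (fun i t => q (dot3 (c t) (c t)) * (c t i + c t0 i)); split.
    move=> i; split.
      apply: (continuous_mult (fun t => q (dot3 (c t) (c t)))).
        exact: (continuous_comp (fun t => dot3 (c t) (c t)) q).
      by apply: (continuous_plus (fun t => c t i)) => //; apply: continuous_const.
    rewrite q2; rewrite /dot3 in S0 *; field; lra.
  apply: filter_forall => t; rewrite /norm3 q3.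
  by rewrite /sum3 /dot3; ring.
- have [P [hP lP]] := he (proj1 hw); have [Q [hQ lQ]] := hf (proj2 hw).
  exists (fun i t => P i t + Q i t); split.
    move=> i; split; last by rewrite (proj2 (hP i)) (proj2 (hQ i)).
    by apply: (continuous_plus (P i)); [apply hP | apply hQ].
  apply: filter_imp (filter_and _ _ lP lQ) => t [h1 h2].
  rewrite /sum3 in h1 h2 *; lra.
- have cf := slopes_continuous _ _ _ _ _ hc (hf (proj2 hw)).
  have [P [hP lP]] := he (proj1 hw); have [Q [hQ lQ]] := hf (proj2 hw).
  exists (fun i t => P i t * ev f (c t) + ev e (c t0) * Q i t); split.
    move=> i; split; last by rewrite (proj2 (hP i)) (proj2 (hQ i)).
    apply: (continuous_plus (fun t => P i t * ev f (c t))).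
      by apply: (continuous_mult (P i)) => //; apply hP.
    by apply: (continuous_mult (fun=> ev e (c t0))); [apply: continuous_const | apply hQ].
  apply: filter_imp (filter_and _ _ lP lQ) => t [h1 h2].
  transitivity ((ev e (c t) - ev e (c t0)) * ev f (c t) + ev e (c t0) * (ev f (c t) - ev f (c t0))); first by ring.
  by rewrite h1 h2 /sum3; ring.
- have [hw1 hw2] := hw.
  have ce := slopes_continuous _ _ _ _ _ hc (he hw1).
  have [P [hP lP]] := he hw1.
  have ci : continuous (fun t => - (/ ev e (c t) * / ev e (c t0))) t0.
    apply: (continuous_opp (fun t => / ev e (c t) * / ev e (c t0))).
    apply: (continuous_mult (fun t => / ev e (c t))); last exact: continuous_const.
    by apply: (continuous_comp (fun t => ev e (c t)) Rinv) => //; apply: continuous_of_derive; auto_derive.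
  exists (fun i t => P i t * - (/ ev e (c t) * / ev e (c t0))); split.
    move=> i; split; last by rewrite (proj2 (hP i)); ring.
    by apply: (continuous_mult (P i)) => //; apply hP.
  have l0 : locally t0 (fun t => ev e (c t) <> 0) := ce _ (open_neq 0 _ hw2).
  apply: filter_imp (filter_and _ _ lP l0) => t [h1 h2].
  transitivity ((ev e (c t) - ev e (c t0)) * - (/ ev e (c t) * / ev e (c t0))); first by field.
  by rewrite h1 /sum3; ring.
Qed.

Lemma continuous_ev (T : UniformSpace) (c : T -> 'I_3 -> R) (t0 : T) (e : expr) :
  (forall i, continuous (fun t => c t i) t0) -> wf e (c t0) -> continuous (fun t => ev e (c t)) t0.
Proof. by move=> hc hw; apply: (slopes_continuous _ _ _ _ _ hc (slopes_ev _ _ _ _ hc hw)). Qed.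

Lemma is_derive_ev (c : R -> 'I_3 -> R) (t0 : R) (e : expr) (d : 'I_3 -> R) :
  (forall i, is_derive (fun t => c t i) t0 (d i)) -> wf e (c t0) ->
  is_derive (fun t => ev e (c t)) t0 (sum3 (fun i => ev (dif i e) (c t0)) d).
Proof.
move=> hd hw.
have hc i : continuous (fun t => c t i) t0 by apply: continuous_of_derive; eexists; exact: hd.
have [P [hP lP]] := slopes_ev R_UniformSpace c t0 e hc hw.
have [q0 [a0 [b0 c0]]] := caratheodory _ _ _ (hd i0).
have [q1 [a1 [b1 c1]]] := caratheodory _ _ _ (hd i1).
have [q2 [a2 [b2 c2]]] := caratheodory _ _ _ (hd i2).
pose q t := P i0 t * q0 t + P i1 t * q1 t + P i2 t * q2 t.
have -> : sum3 (fun i => ev (dif i e) (c t0)) d = q t0.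
  by rewrite /sum3 /q b0 b1 b2 (proj2 (hP i0)) (proj2 (hP i1)) (proj2 (hP i2)).
apply: is_derive_caratheodory.
  apply: (continuous_plus (fun t => P i0 t * q0 t + P i1 t * q1 t)).
    by apply: (continuous_plus (fun t => P i0 t * q0 t)); [apply: (continuous_mult (P i0)) | apply: (continuous_mult (P i1))];
       rewrite //; apply hP.
  by apply: (continuous_mult (P i2)) => //; apply hP.
apply: filter_imp lP => t ->.
by rewrite /sum3 /q c0 c1 c2; ring.
Qed.

Definition edir (D : 'I_3 -> expr) (e : expr) : expr :=
  EAdd (EAdd (EMul (dif i0 e) (D i0)) (EMul (dif i1 e) (D i1))) (EMul (dif i2 e) (D i2)).

Lemma wf_edir (D : 'I_3 -> expr) (e : expr) (p : 'I_3 -> R) :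
  (forall i, wf (D i) p) -> wf e p -> wf (edir D e) p.
Proof. by move=> hD he; rewrite /edir /=; repeat split; try exact: wf_dif; apply: hD. Qed.

(** * Smoothness from first order systems, and differentiation of an inverse *)

Lemma shift0 (n : nat) (v : 'I_n -> R) (j : 'I_n) : shift v j 0 = v.
Proof. by apply: functional_extensionality => i; rewrite /shift; case: eqP => //; rewrite Rplus_0_r. Qed.

Lemma locally_shift (n : nat) (U : ('I_n -> R) -> Prop) (v : fct_UniformSpace 'I_n R_UniformSpace) (j : 'I_n) :
  locally v U -> locally 0 (fun s => U (shift v j s)).
Proof.
move=> [d hd]; exists d => s hs; apply: hd => i.
change (Rabs (s - 0) < d) in hs; change (Rabs (shift v j s i - v i) < d).
rewrite /shift; case: eqP => _.
  by rewrite (_ : v i + s - v i = s - 0); last ring.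
by rewrite (_ : v i - v i = 0) ?Rabs_R0; [exact: cond_pos | ring].
Qed.

Lemma cont_at_continuous (n : nat) (f : ('I_n -> R) -> R) (v : fct_UniformSpace 'I_n R_UniformSpace) :
  continuous (f : fct_UniformSpace 'I_n R_UniformSpace -> R) v -> cont_at f v.
Proof.
move=> /filterlim_locally hf eps eps0.
have [d hd] := hf (mkposreal eps eps0).
exists d; split; first exact: cond_pos.
by move=> w hw; apply: hd => i; exact: hw.
Qed.

(* [g] solves the first order system with right-hand sides [D]; hence functions of the form
   [ev e (g v)] are stable under partial derivatives. *)
Definition ev_system (n : nat) (U : ('I_n -> R) -> Prop) (g : ('I_n -> R) -> 'I_3 -> R)
    (D : 'I_n -> 'I_3 -> expr) : Prop :=
  forall v : fct_UniformSpace 'I_n R_UniformSpace, U v ->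
    locally v U /\
    (forall i, continuous ((fun w => g w i) : fct_UniformSpace 'I_n R_UniformSpace -> R) v) /\
    forall j i, wf (D j i) (g v) /\ is_derive (fun s => g (shift v j s) i) 0 (ev (D j i) (g v)).

Section System.
Context (n : nat) (U : ('I_n -> R) -> Prop) (g : ('I_n -> R) -> 'I_3 -> R) (D : 'I_n -> 'I_3 -> expr).

Lemma is_derive_system (e : expr) (f : ('I_n -> R) -> R) (v : 'I_n -> R) (j : 'I_n) :
  ev_system n U g D -> (forall v, U v -> wf e (g v) /\ f v = ev e (g v)) -> U v ->
  is_derive (fun s => f (shift v j s)) 0 (ev (edir (D j) e) (g v)).
Proof.
move=> hs hf hv; have [hU [hc hD]] := hs v hv.
have hl := locally_shift n U v j hU.
apply: (is_derive_ext_loc (fun s => ev e (g (shift v j s)))).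
  by apply: filter_imp hl => s h; rewrite (proj2 (hf _ h)).
have := is_derive_ev (fun s => g (shift v j s)) 0 e (fun i => ev (D j i) (g v)).
rewrite shift0; apply; first by move=> i; exact: (proj2 (hD j i)).
exact: (proj1 (hf v hv)).
Qed.

Lemma partial_system (e : expr) (f : ('I_n -> R) -> R) (v : 'I_n -> R) (j : 'I_n) :
  ev_system n U g D -> (forall v, U v -> wf e (g v) /\ f v = ev e (g v)) -> U v ->
  wf (edir (D j) e) (g v) /\ partial j f v = ev (edir (D j) e) (g v).
Proof.
move=> hs hf hv; have [_ [_ hD]] := hs v hv; split.
  by apply: wf_edir; [move=> i; exact: (proj1 (hD j i)) | exact: (proj1 (hf v hv))].
by apply: is_derive_unique; apply: is_derive_system.
Qed.

Lemma smooth_system (e : expr) (f : ('I_n -> R) -> R) :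
  ev_system n U g D -> (forall v, U v -> wf e (g v) /\ f v = ev e (g v)) -> smooth_on U f.
Proof.
move=> hs hf k; have hcont e' f' : (forall v, U v -> wf e' (g v) /\ f' v = ev e' (g v)) ->
    forall v, U v -> cont_at f' v.
  move=> hf' v hv; have [hU [hc _]] := hs v hv.
  apply: cont_at_continuous.
  have ce := continuous_ev _ (fun w : fct_UniformSpace 'I_n R_UniformSpace => g w) v e' hc (proj1 (hf' v hv)).
  apply: (continuous_ext_loc _ _ _ _ ce).
  by apply: filter_imp hU => w hw; rewrite (proj2 (hf' w hw)).
elim: k e f hf => [|k IH] e f hf; first exact: hcont hf.
split; first exact: hcont hf.
move=> j; split.
  by move=> v hv; eexists; apply: is_derive_system hs hf hv.
apply: (IH (edir (D j) e)) => v hv.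
exact: partial_system.
Qed.
End System.

(** [c] is only assumed continuous. Cramer's rule is applied to the matrix of slopes, which is
    invertible near [0] by continuity; it expresses the difference quotients of [c] exactly, as
    functions continuous at [0]. *)
Lemma is_derive_cramer (L0 L1 : expr) (c : R -> 'I_3 -> R) (y0 y1 : R) :
  let a00 := ev (dif i0 L0) (c 0) in let a01 := ev (dif i1 L0) (c 0) in
  let a10 := ev (dif i0 L1) (c 0) in let a11 := ev (dif i1 L1) (c 0) in
  (forall i, continuous (fun t => c t i) 0) -> wf L0 (c 0) -> wf L1 (c 0) ->
  (forall t, c t i2 = 0) ->
  locally 0 (fun t => ev L0 (c t) = ev L0 (c 0) + y0 * t /\ ev L1 (c t) = ev L1 (c 0) + y1 * t) ->
  a00 * a11 - a01 * a10 <> 0 ->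
  is_derive (fun t => c t i0) 0 ((y0 * a11 - y1 * a01) / (a00 * a11 - a01 * a10)) /\
  is_derive (fun t => c t i1) 0 ((y1 * a00 - y0 * a10) / (a00 * a11 - a01 * a10)).
Proof.
move=> a00 a01 a10 a11 hc w0 w1 c2 hl det0.
have [P [hP lP]] := slopes_ev R_UniformSpace c 0 L0 hc w0.
have [Q [hQ lQ]] := slopes_ev R_UniformSpace c 0 L1 hc w1.
pose det t := P i0 t * Q i1 t - P i1 t * Q i0 t.
have cm (f g : R -> R) : continuous f 0 -> continuous g 0 -> continuous (fun t => f t * g t) 0.
  by move=> hf hg; apply: (continuous_mult f).
have cd : continuous det 0.
  apply: (continuous_minus (fun t => P i0 t * Q i1 t)); apply: cm.
  - by apply hP. - by apply hQ. - by apply hP. - by apply hQ.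
have det_0 : det 0 = a00 * a11 - a01 * a10.
  by rewrite /det !(proj2 (hP _)) !(proj2 (hQ _)).
have ld : locally 0 (fun t => det t <> 0).
  by apply: (cd _ (open_neq 0 _ _)); rewrite det_0.
have F : Filter (locally (0 : R_UniformSpace)) by apply: filter_filter.
have lall := @filter_and _ _ F _ _ (@filter_and _ _ F _ _ hl ld) (@filter_and _ _ F _ _ lP lQ).
have cn (y y' : R) (f g : R -> R) : continuous f 0 -> continuous g 0 ->
    continuous (fun t => (y * f t - y' * g t) / det t) 0.
  move=> hf hg; apply: continuous_div => //; last by rewrite det_0.
  by apply: (continuous_minus (fun t => y * f t)); apply: cm => //; apply: continuous_const.
split.
- pose q t := (y0 * Q i1 t - y1 * P i1 t) / det t.
  have -> : (y0 * a11 - y1 * a01) / (a00 * a11 - a01 * a10) = q 0.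
    by rewrite /q det_0 !(proj2 (hP _)) !(proj2 (hQ _)).
  apply: is_derive_caratheodory.
    by apply: cn; [apply hQ | apply hP].
  apply: filter_imp lall => t [[[e0 e1] d0] [f0 f1]].
  apply: (Rmult_eq_reg_r (det t)) => //.
  rewrite e0 in f0; rewrite e1 in f1; rewrite /sum3 !c2 in f0 f1.
  have {}f0 : y0 * t = P i0 t * (c t i0 - c 0 i0) + P i1 t * (c t i1 - c 0 i1) by lra.
  have {}f1 : y1 * t = Q i0 t * (c t i0 - c 0 i0) + Q i1 t * (c t i1 - c 0 i1) by lra.
  have -> : q t * (t - 0) * det t = Q i1 t * (y0 * t) - P i1 t * (y1 * t) by rewrite /q; field.
  by rewrite f0 f1 /det; ring.
- pose q t := (y1 * P i0 t - y0 * Q i0 t) / det t.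
  have -> : (y1 * a00 - y0 * a10) / (a00 * a11 - a01 * a10) = q 0.
    by rewrite /q det_0 !(proj2 (hP _)) !(proj2 (hQ _)).
  apply: is_derive_caratheodory.
    by apply: cn; [apply hP | apply hQ].
  apply: filter_imp lall => t [[[e0 e1] d0] [f0 f1]].
  apply: (Rmult_eq_reg_r (det t)) => //.
  rewrite e0 in f0; rewrite e1 in f1; rewrite /sum3 !c2 in f0 f1.
  have {}f0 : y0 * t = P i0 t * (c t i0 - c 0 i0) + P i1 t * (c t i1 - c 0 i1) by lra.
  have {}f1 : y1 * t = Q i0 t * (c t i0 - c 0 i0) + Q i1 t * (c t i1 - c 0 i1) by lra.
  have -> : q t * (t - 0) * det t = P i0 t * (y1 * t) - Q i0 t * (y0 * t) by rewrite /q; field.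
  by rewrite f0 f1 /det; ring.
Qed.

(** * The Jacobian of [Lambda] and the sign of its determinant *)

Definition epsi : expr := EMul (EAdd (ECst 1) (EMul (ECst (- (1))) EZ)) (EInv ESq).
(* [psi'(r) / r] *)
Definition edpsi : expr :=
  EMul (EAdd (EAdd ESq (EMul EZ EZ)) (EAdd EZ (ECst (- (2))))) (EMul (EInv ESq) (EInv ESq)).
Definition eLambda0 : expr := EMul (EVar i1) (EMul (EMul edpsi (EVar i1)) (EVar i0)).
Definition eLambda1 : expr :=
  EMul (EVar i1) (EAdd (EMul (EMul edpsi (EVar i1)) (EVar i1)) (EMul (ECst 2) epsi)).
Definition eK3 : expr := EAdd (EMul (ECst 2) epsi) (EMul edpsi (EMul (EVar i1) (EVar i1))).

Definition embed (v : 'I_2 -> R) : 'I_3 -> R := vec3 (v j0) (v j1) 0.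

Lemma dot3_embed (v : 'I_2 -> R) : dot3 (embed v) (embed v) = v j0 ^ 2 + v j1 ^ 2.
Proof. by rewrite /dot3 /embed /vec3 /=; ring. Qed.

Lemma norm3_embed (v : 'I_2 -> R) : norm3 (embed v) = norm2 v.
Proof. by rewrite /norm3 dot3_embed. Qed.

Lemma wf_EZ (p : 'I_3 -> R) : PI < norm3 p -> norm3 p < 3 / 2 * PI -> wf EZ p /\ ev ESq p <> 0.
Proof.
move=> h1 h2; have p3 := PI_gt_3.
have S0 : 0 < dot3 p p.
  case: (Rle_lt_dec (dot3 p p) 0) => // h.
  by move: h1; rewrite /norm3 sqrt_neg_0 //; lra.
split; first by split=> //; exact: sin_neq0_arc.
by rewrite /=; rewrite /dot3 in S0; lra.
Qed.

Lemma eLambda_spec (v : 'I_2 -> R) : PI < norm2 v -> norm2 v < 3 / 2 * PI ->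
  (wf eLambda0 (embed v) /\ Lambda v j0 = ev eLambda0 (embed v)) /\
  (wf eLambda1 (embed v) /\ Lambda v j1 = ev eLambda1 (embed v)) /\
  (wf eK3 (embed v) /\ K3 v = ev eK3 (embed v)).
Proof.
move=> h1 h2; have p3 := PI_gt_3.
have [[S0 ss] S1] := wf_EZ (embed v) ltac:(by rewrite norm3_embed) ltac:(by rewrite norm3_embed).
have r2 := norm2_sqr v.
rewrite /Lambda /K3 /vec2 /= norm3_embed dpsi_ca // psi_zc; last lra.
rewrite norm3_embed in ss.
rewrite /= in S1; rewrite /ca.
set r := norm2 v in h1 h2 ss r2 *; set z := zc r.
have E : ev ESq (embed v) = r ^ 2 by rewrite r2 /= /embed /vec3 /=; ring.
rewrite /= in E; rewrite !E in S1 *.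
have x1 : embed v i1 = v j1 by []. have x0 : embed v i0 = v j0 by [].
rewrite !x1 !x0.
by repeat split=> //; field; lra.
Qed.

(* [psi], [psi'(r)/r] and [(psi'(r)/r)'/r] in terms of [S = r^2] and [z = zc r]. *)
Definition qpsi (S z : R) : R := (1 - z) / S.
Definition qA (S z : R) : R := (S + z ^ 2 + z - 2) / S ^ 2.
Definition qB (S z : R) : R := - (3 * S + 3 * z ^ 2 + 2 * z * S + 2 * z ^ 3 + 3 * z - 8) / S ^ 3.

Definition jac00 (S z x y : R) : R := qA S z * y ^ 2 + qB S z * x ^ 2 * y ^ 2.
Definition jac01 (S z x y : R) : R := x * y * (2 * qA S z + qB S z * y ^ 2).
Definition jac11 (S z x y : R) : R := 2 * qpsi S z + 5 * qA S z * y ^ 2 + qB S z * y ^ 4.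

Lemma ev_jacobian (p : 'I_3 -> R) : p i2 = 0 -> p i0 ^ 2 + p i1 ^ 2 <> 0 ->
  let S := p i0 ^ 2 + p i1 ^ 2 in let z := zc (norm3 p) in
  ev (dif i0 eLambda0) p = jac00 S z (p i0) (p i1) /\
  ev (dif i1 eLambda0) p = jac01 S z (p i0) (p i1) /\
  ev (dif i0 eLambda1) p = jac01 S z (p i0) (p i1) /\
  ev (dif i1 eLambda1) p = jac11 S z (p i0) (p i1).
Proof.
move=> p2 S0 S z.
rewrite /= /kron /= p2 -/z /S /jac00 /jac01 /jac11 /qpsi /qA /qB.
move: (p i0) (p i1) S0 => x y S0.
have e : x * x + y * y + 0 * 0 <> 0 by move=> h; apply: S0; rewrite -h; ring.
by repeat split; field.
Qed.

Lemma jacobian_det_neg (S z x y : R) : S = x ^ 2 + y ^ 2 -> 9 < S -> 1 < z -> y <> 0 ->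
  2 * qpsi S z + qA S z * y ^ 2 < 0 ->
  jac00 S z x y * jac11 S z x y - jac01 S z x y ^ 2 < 0.
Proof.
move=> SE S9 z1 y0 hK.
(* With [qA = a / r^3] and [qpsi = - b / (2 r)], the middle bound is [2 b <= a] divided by [r]. *)
have [A0 [AP B0]] : 0 < qA S z /\ - 4 * qpsi S z <= qA S z * S /\ qB S z < 0.
  split; first by apply: Rdiv_lt_0_compat; nra.
  split.
    have -> : qA S z * S = (S + z ^ 2 + z - 2) / S by rewrite /qA; field; lra.
    rewrite /qpsi (_ : - 4 * ((1 - z) / S) = 4 * (z - 1) / S); last by field; lra.
    apply: Rmult_le_compat_r; first by left; apply: Rinv_0_lt_compat; lra.
    by have := pow2_ge_0 (z - 3 / 2); nra.
  have : 0 < (3 * S + 3 * z ^ 2 + 2 * z * S + 2 * z ^ 3 + 3 * z - 8) / S ^ 3.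
    have : 0 < z ^ 3 by apply: pow_lt; lra.
    by move=> ?; apply: Rdiv_lt_0_compat; [nra | apply: pow_lt; lra].
  by rewrite /qB /Rdiv; lra.
have P0 : qpsi S z < 0.
  have : 0 < (z - 1) / S by apply: Rdiv_lt_0_compat; lra.
  by rewrite /qpsi /Rdiv; lra.
(* The left side is [(2 b' a - b a') / r^3], so its sign is that of the derivative of [b^2 / a]. *)
have F0 : 2 * qpsi S z * (qA S z + qB S z * S) - 4 * qA S z ^ 2 * S < 0.
  have -> : 2 * qpsi S z * (qA S z + qB S z * S) - 4 * qA S z ^ 2 * S =
     - (4 * ((S + z ^ 2) * (S + 2 * z - 3) + 1) / S ^ 3).
    by rewrite /qpsi /qA /qB; field; lra.
  suff : 0 < 4 * ((S + z ^ 2) * (S + 2 * z - 3) + 1) / S ^ 3 by lra.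
  by apply: Rdiv_lt_0_compat; [nra | apply: pow_lt; lra].
rewrite /jac00 /jac01 /jac11.
move: (qA S z) (qB S z) (qpsi S z) hK A0 AP B0 P0 F0 => A B psi hK A0 AP B0 P0 F0.
(* The determinant is [W F(W)] with [W = y^2] and [F] affine; [F] is negative at [0]
   and at the boundary value [w] where [K3] vanishes. *)
pose w := - 2 * psi / A; pose W := y ^ 2.
have psiE : psi = - (A * w) / 2 by rewrite /w; field; lra.
pose F t := 2 * psi * A + 5 * A ^ 2 * t + A * B * S * t + 2 * psi * B * (S - t) - 4 * A ^ 2 * (S - t).
have W0 : 0 < W by rewrite /W; nra.
have w0 : 0 < w by apply: Rdiv_lt_0_compat; lra.
have Ww : W < w by rewrite /W; nra.
have wS : 2 * w <= S by nra.
have Fw : F w < 0.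
  have -> : F w = A * (4 * A * (2 * w - S) + B * w ^ 2) by rewrite /F psiE; field.
  have : 4 * A * (2 * w - S) <= 0 by nra.
  have : 0 < - B * w ^ 2 by apply: Rmult_lt_0_compat; [lra | exact: pow_lt].
  nra.
have FW : F W < 0.
  have e : F W * w = F 0 * (w - W) + W * F w by rewrite /F; ring.
  have f0 : F 0 < 0 by rewrite /F; lra.
  have : F 0 * (w - W) < 0 by nra.
  have : W * F w < 0 by nra.
  nra.
suff -> : (A * y ^ 2 + B * x ^ 2 * y ^ 2) * (2 * psi + 5 * A * y ^ 2 + B * y ^ 4) -
  (x * y * (2 * A + B * y ^ 2)) ^ 2 = W * F W by nra.
by rewrite /F /W SE; ring.
Qed.

Lemma Jacobian_neg (th : R) (v : 'I_2 -> R) : first_tan_fixpoint th -> Omega_m4 th v ->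
  let p := embed v in let S := v j0 ^ 2 + v j1 ^ 2 in let z := zc (norm2 v) in
  (wf eLambda0 p /\ wf eLambda1 p) /\
  (ev (dif i0 eLambda0) p = jac00 S z (v j0) (v j1) /\
   ev (dif i1 eLambda0) p = jac01 S z (v j0) (v j1) /\
   ev (dif i0 eLambda1) p = jac01 S z (v j0) (v j1) /\
   ev (dif i1 eLambda1) p = jac11 S z (v j0) (v j1)) /\
  jac00 S z (v j0) (v j1) * jac11 S z (v j0) (v j1) - jac01 S z (v j0) (v j1) ^ 2 < 0 /\
  K3 v = 2 * qpsi S z + qA S z * v j1 ^ 2.
Proof.
move=> hth hO p S z; have p3 := PI_gt_3; have [_ [hth2 _]] := hth.
have [hr [hk [v0 v1]]] := Omega_polar th v hth hO.
have [[w0 _] [[w1 _] [wk kE]]] := eLambda_spec v ltac:(lra) ltac:(lra).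
split=> //.
have S9 : 9 < S by rewrite /S -norm2_sqr; nra.
have [e0 [e1 [e2 e3]]] := ev_jacobian p erefl ltac:(rewrite /p /embed /vec3 /=; rewrite /S in S9; lra).
rewrite /p norm3_embed in e0 e1 e2 e3.
have kk : K3 v = 2 * qpsi S z + qA S z * v j1 ^ 2.
  rewrite kE /= norm3_embed /embed /vec3 /= -/z.
  have -> : v j0 * v j0 + v j1 * v j1 + 0 * 0 = S by rewrite /S; ring.
  by rewrite /qpsi /qA; field; lra.
split=> //; split=> //.
apply: jacobian_det_neg => //.
- by apply: (zc_gt1 th) => //; lra.
- by lra.
- by rewrite -kk; have [_ [_ [_ [_]]]] := hO.
Qed.

(** * The systems satisfied by the identity and by the inverse of [Lambda] *)

Lemma continuous_norm2 (v : fct_UniformSpace 'I_2 R_UniformSpace) :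
  continuous (norm2 : fct_UniformSpace 'I_2 R_UniformSpace -> R) v.
Proof.
apply: (continuous_comp (fun w : fct_UniformSpace 'I_2 R_UniformSpace => w j0 ^ 2 + w j1 ^ 2) sqrt);
  last exact: continuous_sqrt.
by apply: (continuous_plus (fun w : fct_UniformSpace 'I_2 R_UniformSpace => w j0 ^ 2));
  apply: continuous_pow; apply: continuous_coord.
Qed.

Lemma continuous_embed (v : fct_UniformSpace 'I_2 R_UniformSpace) (i : 'I_3) :
  continuous (fun w : fct_UniformSpace 'I_2 R_UniformSpace => embed w i) v.
Proof.
move: i; apply: ord3P; [exact: (continuous_coord 2 j0) | exact: (continuous_coord 2 j1) |].
exact: continuous_const.
Qed.

Lemma locally_Omega (th : R) (v : fct_UniformSpace 'I_2 R_UniformSpace) :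
  first_tan_fixpoint th -> Omega_m4 th v -> locally v (Omega_m4 th).
Proof.
move=> hth hO; have p3 := PI_gt_3; have [_ [hth2 _]] := hth.
have [hr _] := Omega_polar th v hth hO.
have [v1 [v0 [vr [rth hK]]]] := hO.
have c0 := continuous_coord 2 j0 v; have c1 := continuous_coord 2 j1 v.
have cn := continuous_norm2 v.
have l1 : locally v (fun w => w j1 < 0) := c1 _ (open_lt 0 _ v1).
have l0 : locally v (fun w => PI < w j0) := c0 _ (open_gt PI _ v0).
have ln : locally v (fun w => norm2 w < th) := cn _ (open_lt th _ rth).
have lp : locally v (fun w => PI < norm2 w) := cn _ (open_gt PI _ (proj1 hr)).
have ld : locally v (fun w => 0 < norm2 w - w j0).
  have cd : continuous (fun w : fct_UniformSpace 'I_2 R_UniformSpace => norm2 w - w j0) v.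
    exact: (continuous_minus (norm2 : fct_UniformSpace 'I_2 R_UniformSpace -> R)).
  by apply: (cd _ (open_gt 0 _ _)); lra.
have lr : locally v (fun w => PI < norm2 w /\ norm2 w < th) by exact: filter_and.
have [_ [_ [wk _]]] := eLambda_spec v ltac:(lra) ltac:(lra).
have cK : continuous (K3 : fct_UniformSpace 'I_2 R_UniformSpace -> R) v.
  have ce := continuous_ev _ (fun w : fct_UniformSpace 'I_2 R_UniformSpace => embed w) v eK3
    (continuous_embed v) wk.
  apply: (continuous_ext_loc _ _ _ _ ce).
  apply: filter_imp lr => w [w1 w2].
  by have [_ [_ [_ ->]]] := eLambda_spec w ltac:(lra) ltac:(lra).
have lk : locally v (fun w => K3 w < 0) := cK _ (open_lt 0 _ hK).
apply: filter_imp (filter_and _ _ (filter_and _ _ l1 l0) (filter_and _ _ (filter_and _ _ ld ln) lk)).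
by move=> w [[h1 h2] [[h3 h4] h5]]; repeat split=> //; lra.
Qed.

Lemma embed_system (th : R) : first_tan_fixpoint th ->
  ev_system 2 (Omega_m4 th) embed (fun j i => ECst (embed (kron j) i)).
Proof.
move=> hth v hv; split; first exact: locally_Omega.
split; first exact: continuous_embed.
move=> j i; split=> //=; move: i; apply: ord3P; rewrite /embed /vec3 /= /shift /kron.
- rewrite eq_sym; case: eqP => _; auto_derive=> //; ring.
- rewrite eq_sym; case: eqP => _; auto_derive=> //; ring.
- by auto_derive.
Qed.

Definition edet : expr :=
  EAdd (EMul (dif i0 eLambda0) (dif i1 eLambda1))
    (EMul (ECst (- (1))) (EMul (dif i1 eLambda0) (dif i0 eLambda1))).

Definition einverse (j : 'I_2) (i : 'I_3) : expr :=
  match nat_of_ord i with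
  | 0%nat => EMul (EAdd (EMul (ECst (kron j j0)) (dif i1 eLambda1))
               (EMul (ECst (- kron j j1)) (dif i1 eLambda0))) (EInv edet)
  | 1%nat => EMul (EAdd (EMul (ECst (kron j j1)) (dif i0 eLambda0))
               (EMul (ECst (- kron j j0)) (dif i0 eLambda1))) (EInv edet)
  | _ => ECst 0
  end.

Lemma LambdaInv_system (th : R) : first_tan_fixpoint th ->
  ev_system 2 R2_lt_plus (fun u => embed (LambdaInv th u)) einverse.
Proof.
move=> hth u hu; have p3 := PI_gt_3; have [_ [hth2 _]] := hth.
have [hO hL] := LambdaInv_spec th u hth hu.
set v := LambdaInv th u in hO hL *.
have hc i : continuous (fun w : fct_UniformSpace 'I_2 R_UniformSpace => embed (LambdaInv th w) i) u.
  move: i; apply: ord3P; [exact: (continuous_LambdaInv th u j0) | exact: (continuous_LambdaInv th u j1) |].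
  exact: continuous_const.
split; first exact: locally_R2_lt_plus.
split=> //.
have [[w0 w1] [[e00 [e01 [e10 e11]]] [hdet _]]] := Jacobian_neg th v hth hO.
have d0 : ev edet (embed v) <> 0.
  rewrite /edet.
  change (ev (dif i0 eLambda0) (embed v) * ev (dif i1 eLambda1) (embed v) +
    - (1) * (ev (dif i1 eLambda0) (embed v) * ev (dif i0 eLambda1) (embed v)) <> 0).
  rewrite e00 e01 e10 e11; lra.
have wd (k : 'I_3) : wf (dif k eLambda0) (embed v) /\ wf (dif k eLambda1) (embed v).
  by split; apply: wf_dif.
have wdet : wf edet (embed v).
  by split; [split; apply wd | split=> //; split; apply wd].
have winv j i : wf (einverse j i) (embed v).
  by move: i; apply: ord3P; rewrite /einverse => //;
    split; try (split=> //); split; split=> //; apply wd.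
move=> j i; split=> //.
pose c t := embed (LambdaInv th (shift u j t)).
have c0 : c 0 = embed v by rewrite /c shift0.
have hl := locally_shift 2 R2_lt_plus u j (locally_R2_lt_plus u hu).
have cs : continuous ((fun t : R => shift u j t) : R -> fct_UniformSpace 'I_2 R_UniformSpace) 0.
  apply/filterlim_locally => eps; rewrite shift0.
  by apply: locally_shift; exists eps.
have hcc k : continuous (fun t => c t k) 0.
  apply: (continuous_comp (fun t : R => (shift u j t : fct_UniformSpace 'I_2 R_UniformSpace))
    (fun w : fct_UniformSpace 'I_2 R_UniformSpace => embed (LambdaInv th w) k)) => //.
  by rewrite shift0.
(* Moving [u] along the axis [j] makes the image of the preimage curve affine in [t], as
   [is_derive_cramer] requires. *)
have le : locally 0 (fun t => ev eLambda0 (c t) = ev eLambda0 (c 0) + kron j j0 * t /\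
    ev eLambda1 (c t) = ev eLambda1 (c 0) + kron j j1 * t).
  apply: filter_imp hl => t ht.
  have key w : R2_lt_plus w -> ev eLambda0 (embed (LambdaInv th w)) = w j0 /\
      ev eLambda1 (embed (LambdaInv th w)) = w j1.
    move=> hw; have [hwO hwL] := LambdaInv_spec th w hth hw.
    have [hwr _] := Omega_polar th _ hth hwO.
    have [[_ <-] [[_ <-] _]] := eLambda_spec (LambdaInv th w) ltac:(lra) ltac:(lra).
    by rewrite !hwL.
  have [k0 k1] := key _ ht; have [k2 k3] := key _ hu.
  rewrite c0 /c /v k0 k1 k2 k3 /shift /kron.
  by rewrite ![_ == j]eq_sym; split; case: eqP => _; rewrite ?Rmult_1_l ?Rmult_0_l ?Rplus_0_r.
have := is_derive_cramer eLambda0 eLambda1 c (kron j j0) (kron j j1).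
rewrite c0 in le *; move=> /(_ hcc w0 w1 (fun=> erefl) le).
have dE : ev (dif i0 eLambda0) (embed v) * ev (dif i1 eLambda1) (embed v) -
   ev (dif i1 eLambda0) (embed v) * ev (dif i0 eLambda1) (embed v) = ev edet (embed v).
  rewrite /edet.
  change (ev (dif i0 eLambda0) (embed v) * ev (dif i1 eLambda1) (embed v) -
   ev (dif i1 eLambda0) (embed v) * ev (dif i0 eLambda1) (embed v) =
   ev (dif i0 eLambda0) (embed v) * ev (dif i1 eLambda1) (embed v) +
    - (1) * (ev (dif i1 eLambda0) (embed v) * ev (dif i0 eLambda1) (embed v))).
  ring.
rewrite dE => /(_ d0) [h0 h1].
move: i; apply: ord3P.
- have -> : ev (einverse j i0) (embed v) =
    (kron j j0 * ev (dif i1 eLambda1) (embed v) - kron j j1 * ev (dif i1 eLambda0) (embed v)) / ev edet (embed v).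
    transitivity ((kron j j0 * ev (dif i1 eLambda1) (embed v) + - kron j j1 * ev (dif i1 eLambda0) (embed v))
      * / ev edet (embed v)) => //; rewrite /Rdiv; ring.
  exact: h0.
- have -> : ev (einverse j i1) (embed v) =
    (kron j j1 * ev (dif i0 eLambda0) (embed v) - kron j j0 * ev (dif i0 eLambda1) (embed v)) / ev edet (embed v).
    transitivity ((kron j j1 * ev (dif i0 eLambda0) (embed v) + - kron j j0 * ev (dif i0 eLambda1) (embed v))
      * / ev edet (embed v)) => //; rewrite /Rdiv; ring.
  exact: h1.
- by rewrite /einverse /embed /vec3 /=; auto_derive.
Qed.

Lemma Lambda_diffeo (th : R) : first_tan_fixpoint th ->
  diffeo_with_inverse (Omega_m4 th) R2_lt_plus Lambda (LambdaInv th).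
Proof.
move=> hth; have p3 := PI_gt_3; have [_ [hth2 _]] := hth.
split; first by move=> v; exact: Lambda_range.
split; first by move=> u hu; exact: (proj1 (LambdaInv_spec th u hth hu)).
split; first by move=> v; exact: LambdaK.
split; first by move=> u hu; exact: (proj2 (LambdaInv_spec th u hth hu)).
have sp v : Omega_m4 th v -> PI < norm2 v /\ norm2 v < 3 / 2 * PI.
  by move=> hv; have [hr _] := Omega_polar th v hth hv; lra.
split.
  apply: ord2P.
    apply: (smooth_system _ _ _ _ eLambda0 _ (embed_system th hth)) => v /sp [h1 h2].
    by have [? _] := eLambda_spec v h1 h2.
  apply: (smooth_system _ _ _ _ eLambda1 _ (embed_system th hth)) => v /sp [h1 h2].
  by have [_ [? _]] := eLambda_spec v h1 h2.
apply: ord2P.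
  exact: (smooth_system _ _ _ _ (EVar i0) _ (LambdaInv_system th hth)).
exact: (smooth_system _ _ _ _ (EVar i1) _ (LambdaInv_system th hth)).
Qed.

(** * The Hessian of [phi] at [theta] *)

Lemma quadratic_roots (p q s : R) : p * s - q * q < 0 ->
  exists l1 l2 : R, l1 + l2 = p + s /\ l1 * l2 = p * s - q * q /\ 0 < l1 /\ l2 < 0.
Proof.
move=> h.
pose D := (p + s) ^ 2 - 4 * (p * s - q * q).
have D0 : 0 < D by rewrite /D; have := pow2_ge_0 (p + s); lra.
have sD : sqrt D ^ 2 = D by apply: pow2_sqrt; lra.
have s0 : 0 < sqrt D by apply: sqrt_lt_R0.
have e : (p + s + sqrt D) / 2 * ((p + s - sqrt D) / 2) = p * s - q * q.
  transitivity (((p + s) ^ 2 - sqrt D ^ 2) / 4); first by field.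
  by rewrite sD /D; field.
exists ((p + s + sqrt D) / 2), ((p + s - sqrt D) / 2); split; first by field.
split=> //; rewrite -e in h.
have : (p + s - sqrt D) / 2 < (p + s + sqrt D) / 2 by lra.
by move: (_ / 2) ((p + s + _) / 2) h => l2 l1 h hl; split; nra.
Qed.

Definition ephi (a u0 u1 : R) : expr :=
  EAdd (EAdd (EMul (ECst (a ^ 2)) EZ) (EMul epsi (EMul (ECst (a ^ 2)) (EMul (EVar i0) (EVar i0)))))
    (EAdd (EMul (ECst (a ^ 2 * u0)) (EVar i0)) (EMul (ECst (a ^ 2 * u1)) (EVar i1))).

(** An open set of [R^3] containing [theta]: derivatives in the third direction leave the plane, so
    [phi] must agree with its expression on a full neighbourhood. *)
Definition shell (p : 'I_3 -> R) : Prop := PI < norm3 p /\ norm3 p < 3 / 2 * PI.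

Lemma ephi_spec (a u0 u1 : R) (p : 'I_3 -> R) : shell p ->
  wf (ephi a u0 u1) p /\
  phi (vec3 a 0 0) (vec3 (a ^ 2 / 4 * u0) (a ^ 2 / 4 * u1) 0) p = ev (ephi a u0 u1) p.
Proof.
move=> [h1 h2]; have p3 := PI_gt_3.
have [[S0 ss] S1] := wf_EZ p h1 h2.
have xE : norm3 (vec3 a 0 0) ^ 2 = a ^ 2.
  by rewrite pow2_sqrt /dot3 /vec3 /=; [ring | nra].
split; first by rewrite /= in S1 *.
rewrite /phi xE psi_zc; last lra.
have r2 : norm3 p ^ 2 = p i0 * p i0 + p i1 * p i1 + p i2 * p i2 by apply: pow2_sqrt; lra.
rewrite /= -r2 in S1 *.
rewrite /dot3 /vec3 /= /zc; field; lra.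
Qed.

Lemma shell_system : ev_system 3 shell id (fun j i => ECst (kron j i)).
Proof.
move=> p [h1 h2].
have hc i : continuous (fun w : fct_UniformSpace 'I_3 R_UniformSpace => w i) p := continuous_coord 3 i p.
have cn : continuous (norm3 : fct_UniformSpace 'I_3 R_UniformSpace -> R) p.
  apply: (continuous_comp (fun w : fct_UniformSpace 'I_3 R_UniformSpace => dot3 w w) sqrt);
    last exact: continuous_sqrt.
  exact: (continuous_norm_sqr _ (fun w : fct_UniformSpace 'I_3 R_UniformSpace => w)).
split.
  have l1 : locally p (fun w => PI < norm3 w) := cn _ (open_gt PI _ h1).
  have l2 : locally p (fun w => norm3 w < 3 / 2 * PI) := cn _ (open_lt (3 / 2 * PI) _ h2).
  exact: (filter_and _ _ l1 l2).
split=> // j i; split=> //=; rewrite /shift /kron eq_sym.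
by case: eqP => _; auto_derive=> //; ring.
Qed.

Lemma hessian_phi (a u0 u1 : R) (v : 'I_2 -> R) : PI < norm2 v -> norm2 v < 3 / 2 * PI ->
  let f := phi (vec3 a 0 0) (vec3 (a ^ 2 / 4 * u0) (a ^ 2 / 4 * u1) 0) in
  let H i j := partial i (partial j f) (embed v) in
  let S := v j0 ^ 2 + v j1 ^ 2 in let z := zc (norm2 v) in
  (H i0 i0 = - a ^ 2 * jac00 S z (v j0) (v j1) /\
   H i0 i1 = - a ^ 2 * jac01 S z (v j0) (v j1) /\
   H i1 i0 = - a ^ 2 * jac01 S z (v j0) (v j1) /\
   H i1 i1 = - a ^ 2 * jac11 S z (v j0) (v j1)) /\
  H i2 i2 = - a ^ 2 * (2 * qpsi S z + qA S z * v j1 ^ 2) /\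
  (H i0 i2 = 0 /\ H i1 i2 = 0 /\ H i2 i0 = 0 /\ H i2 i1 = 0).
Proof.
move=> h1 h2 f H S z; have p3 := PI_gt_3.
pose D (j i : 'I_3) := ECst (kron j i).
have hv : shell (embed v) by rewrite /shell norm3_embed.
have hE i j : H i j = ev (edir (D i) (edir (D j) (ephi a u0 u1))) (embed v).
  apply: (proj2 (partial_system 3 shell id D _ _ _ _ shell_system _ hv)) => p hp.
  apply: (partial_system 3 shell id D _ _ _ _ shell_system _ hp) => p' hp'.
  exact: ephi_spec.
have S0 : S <> 0 by rewrite /S -norm2_sqr; nra.
have n3 : norm3 (embed v) = norm2 v := norm3_embed v.
have e : v j0 * v j0 + v j1 * v j1 + 0 * 0 <> 0 by move=> h; apply: S0; rewrite -h /S; ring.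
have x0 : embed v i0 = v j0 by [].
have x1 : embed v i1 = v j1 by [].
have x2 : embed v i2 = 0 by [].
rewrite !hE /edir /D /= /kron /= n3 x0 x1 x2 -/z /S /jac00 /jac01 /jac11 /qpsi /qA /qB.
rewrite /S in S0.
move: (v j0) (v j1) z S0 e => x y z S0 e.
by refine (conj (conj _ (conj _ (conj _ _))) (conj _ (conj _ (conj _ (conj _ _))))); field; (tauto || lra).
Qed.

From mathcomp Require Import ring.

Import GRing.Theory.
Local Open Scope ring_scope.

(** * Eigenvalues of a block matrix *)

Lemma det_mx33 (A : comNzRingType) (M : 'M[A]_3) :
  \det M = M i0 i0 * (M i1 i1 * M i2 i2 - M i1 i2 * M i2 i1)
         - M i0 i1 * (M i1 i0 * M i2 i2 - M i1 i2 * M i2 i0)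
         + M i0 i2 * (M i1 i0 * M i2 i1 - M i1 i1 * M i2 i0).
Proof.
pose F (i j : nat) := M (inord i) (inord j).
have ME i j : M i j = F i j by rewrite /F !inord_val.
rewrite !ME (expand_det_row _ 0) !big_ord_recl big_ord0 /cofactor !(expand_det_row _ 0).
rewrite !big_ord_recl !big_ord0 /cofactor !det_mx11 !mxE !ME /= /bump /=.
rewrite !addn0 !add0n; ring.
Qed.

Lemma char_poly_block (p q s k : R) (A : 'M[R]_3) :
  A i0 i0 = p -> A i0 i1 = q -> A i1 i0 = q -> A i1 i1 = s -> A i2 i2 = k ->
  A i0 i2 = 0 -> A i1 i2 = 0 -> A i2 i0 = 0 -> A i2 i1 = 0 ->
  char_poly A = (('X - p%:P) * ('X - s%:P) - (q * q)%:P) * ('X - k%:P).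
Proof.
move=> h00 h01 h10 h11 h22 h02 h12 h20 h21.
rewrite /char_poly det_mx33 !mxE h00 h01 h10 h11 h22 h02 h12 h20 h21 /= polyCM.
rewrite !mulr0n !mulr1n !polyC0; ring.
Qed.

Lemma quadratic_split (p q s l1 l2 : R) : l1 + l2 = p + s -> l1 * l2 = p * s - q * q ->
  ('X - p%:P) * ('X - s%:P) - (q * q)%:P = ('X - l1%:P) * ('X - l2%:P) :> {poly R}.
Proof.
move=> hs hp.
have hsP : l1%:P + l2%:P = p%:P + s%:P :> {poly R} by rewrite -!polyCD hs.
have hpP : l1%:P * l2%:P = p%:P * s%:P - (q * q)%:P :> {poly R} by rewrite -!polyCM -polyCB hp.
have -> : ('X - l1%:P) * ('X - l2%:P) = 'X * 'X - (l1%:P + l2%:P) * 'X + l1%:P * l2%:P :> {poly R} by ring.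
by rewrite hsP hpP; ring.
Qed.

(** The symmetric block of negative determinant contributes one eigenvalue of each sign; the
    isolated entry [k] is the second positive one. *)
Lemma block_eigenvalues (p q s k : R) (A : 'M[R]_3) :
  A i0 i0 = p -> A i0 i1 = q -> A i1 i0 = q -> A i1 i1 = s -> A i2 i2 = k ->
  A i0 i2 = 0 -> A i1 i2 = 0 -> A i2 i0 = 0 -> A i2 i1 = 0 ->
  Rlt (p * s - q * q) 0 -> Rlt 0 k ->
  nonsingular A /\ exists l : seq R, eigenvalues_are A l /\ npos l = 2%N.
Proof.
move=> h00 h01 h10 h11 h22 h02 h12 h20 h21 det0 k0.
have [l1 [l2 [hs [hp [l10 l20]]]]] := quadratic_roots p q s det0.
have cE := char_poly_block p q s k A h00 h01 h10 h11 h22 h02 h12 h20 h21.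
split.
  rewrite /nonsingular det_mx33 h00 h01 h10 h11 h22 h02 h12 h20 h21.
  have -> : p * (s * k - 0 * 0) - q * (q * k - 0 * 0) + 0 * (q * 0 - s * 0) = (p * s - q * q) * k by ring.
  apply: mulf_neq0; apply/eqP => h.
    exact: (Rlt_not_eq _ _ det0 h).
  exact: (Rlt_not_eq _ _ k0 (esym h)).
exists [:: l1; l2; k]; split.
  by split=> //; rewrite cE (quadratic_split _ _ _ l1 l2) // !big_cons big_nil mulr1 mulrA.
rewrite /npos /= (introT RltP l10) (introT RltP k0).
by rewrite (introF RltP) //; apply: Rlt_asym.
Qed.

Local Close Scope ring_scope.
Local Open Scope R_scope.

Theorem theorem11p5 :
  forall theta1 : R,
    PI < theta1 -> theta1 < 3 / 2 * PI -> tan theta1 = theta1 ->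
    (forall s : R, PI < s -> s < 3 / 2 * PI -> tan s = s -> s = theta1) ->
  exists LambdaInv : ('I_2 -> R) -> ('I_2 -> R),
    diffeo_with_inverse (Omega_m4 theta1) R2_lt_plus Lambda LambdaInv /\
    forall (a : R) (u : 'I_2 -> R),
      0 < a -> R2_lt_plus u ->
      let x := vec3 a 0 0 in
      let t := vec3 (a ^ 2 / 4 * u j0) (a ^ 2 / 4 * u j1) 0 in
      let theta := vec3 (LambdaInv u j0) (LambdaInv u j1) 0 in
      let H := hessian3 (phi x t) theta in
      nonsingular H /\
      exists s : seq R, eigenvalues_are H s /\
        npos s = 2%nat.
Proof.
move=> th h1 h2 h3 _; have hth : first_tan_fixpoint th by [].
exists (LambdaInv th); split; first exact: Lambda_diffeo.
move=> a u a0 hu x t theta H; have p3 := PI_gt_3.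
have [hO _] := LambdaInv_spec th u hth hu.
have hK : K3 (LambdaInv th u) < 0 by have [_ [_ [_ [_]]]] := hO.
have [hr _] := Omega_polar th _ hth hO.
have [_ [_ [hdet hKE]]] := Jacobian_neg th _ hth hO.
have [[e00 [e01 [e10 e11]]] [e22 [e02 [e12 [e20 e21]]]]] :=
  hessian_phi a (u j0) (u j1) (LambdaInv th u) ltac:(lra) ltac:(lra).
have aa : 0 < a ^ 2 by apply: pow_lt.
have HE i j : H i j = partial i (partial j (phi x t)) theta by rewrite mxE.
apply: (block_eigenvalues _ _ _ _ H (etrans (HE _ _) e00) (etrans (HE _ _) e01) (etrans (HE _ _) e10)
  (etrans (HE _ _) e11) (etrans (HE _ _) e22) (etrans (HE _ _) e02) (etrans (HE _ _) e12)
  (etrans (HE _ _) e20) (etrans (HE _ _) e21)).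
(* The factor [- a^2] enters the block determinant squared and keeps its sign, whereas it reverses
   the sign of [K3] in the last entry. *)
- set J00 := jac00 _ _ _ _ in hdet *; set J01 := jac01 _ _ _ _ in hdet *; set J11 := jac11 _ _ _ _ in hdet *.
  suff : 0 < (a ^ 2) ^ 2 * - (J00 * J11 - J01 ^ 2) by lra.
  by apply: Rmult_lt_0_compat; [exact: pow_lt | lra].
- rewrite -hKE; nra.
Qed.
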